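(* Let $\{V_j:j\in\mathbb{Z}\}$ be an MRA of $L^2(K)$ with scaling function $\varphi$, let $W_j=V_{j+1}\ominus V_j$ be the orthogonal complement of $V_j$ in $V_{j+1}$, and let $\{\omega_n:n\ge0\}$ be the associated wavelet packets. Then: (i) for every $j\ge0$, $\{\omega_n(\cdot-u(k)):q^j\le n\le q^{j+1}-1,\ k\in\mathbb{N}_0\}$ is an orthonormal basis of $W_j$; (ii) for every $j\ge0$, $\{\omega_n(\cdot-u(k)):0\le n\le q^j-1,\ k\in\mathbb{N}_0\}$ is an orthonormal basis of $V_j$; (iii) $\{\omega_n(\cdot-u(k)):n\ge0,\ k\in\mathbb{N}_0\}$ is an orthonormal basis of $L^2(K)$.
   Context: $K$ is a local field (a nondiscrete, totally disconnected, locally compact topological field) of characteristic $p>0$. Let $dx$ be Haar measure on the additive group $K^+$ and $|\cdot|$ the absolute value given by $d(\alpha x)=|\alpha|\,dx$, $|0|=0$. Put $\mathfrak{D}=\{x:|x|\le1\}$, $\mathfrak{P}=\{x:|x|<1\}$, $\mathfrak{D}^*=\mathfrak{D}\setminus\mathfrak{P}$; $dx$ is normalized so that $\mathfrak{D}$ has measure $1$. $\mathfrak{p}$ is a fixed element of $\mathfrak{P}$ of maximal absolute value (a prime element), $\mathfrak{D}/\mathfrak{P}\cong GF(q)$ with $q=p^c$, and $|\mathfrak{p}|=q^{-1}$. $\mathbb{N}_0=\{0,1,2,\dots\}$. Fix $\{1=\epsilon_0,\epsilon_1,\dots,\epsilon_{c-1}\}\subset\mathfrak{D}^*$ whose $GF(p)$-linear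 span is isomorphic to $GF(q)$ (as a field). For $0\le n<q$ with $n=a_0+a_1p+\cdots+a_{c-1}p^{c-1}$, $0\le a_k<p$, put $u(n)=(a_0+a_1\epsilon_1+\cdots+a_{c-1}\epsilon_{c-1})\mathfrak{p}^{-1}$; for general $n\in\mathbb{N}_0$ with $n=b_0+b_1q+\cdots+b_sq^s$, $0\le b_k<q$, put $u(n)=u(b_0)+u(b_1)\mathfrak{p}^{-1}+\cdots+u(b_s)\mathfrak{p}^{-s}$. Then $\{u(n)\}_{n\ge0}$ is a complete list of distinct coset representatives of $\mathfrak{D}$ in $K^+$. $\chi$ is the continuous unitary character of $K^+$ determined by $\chi(\epsilon_\mu\mathfrak{p}^{-j})=\exp(2\pi i/p)$ if $\mu=0$ and $j=1$, and $\chi(\epsilon_\mu\mathfrak{p}^{-j})=1$ if $\mu\in\{1,\dots,c-1\}$ or $j\ne1$; it is trivial on $\mathfrak{D}$ and nontrivial on $\mathfrak{p}^{-1}\mathfrak{D}$. Put $\chi_k(\xi)=\chi(u(k)\xi)$ for $k\in\mathbb{N}_0$. The Fourier transform is $\hat f(\xi)=\int_K f(x)\overline{\chi(\xi x)}\,dx$ on $L^1(K)$, extended to a unitary operator on $L^2(K)$. MRA: a sequence $\{V_j\}_{j\in\mathbb{Z}}$ of closed subspaces of $L^2(K)$ such that (a) $V_j\subset V_{j+1}$ for all $j$; (b) $\bigcup_jV_j$ is dense in $L^2(K)$ and $\bigcap_jV_j=\{0\}$; (c) $f\in V_j$ iff $f(\mathfrak{p}^{-1}\cdot)\in V_{j+1}$,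 for all $j$; (d) there is $\varphi\in V_0$ (the scaling function) such that $\{\varphi(\cdot-u(k)):k\in\mathbb{N}_0\}$ is an orthonormal basis of $V_0$. Filters: since $\varphi\in V_0\subset V_1$, $\varphi(x)=q^{1/2}\sum_{k\in\mathbb{N}_0}h^0_k\varphi(\mathfrak{p}^{-1}x-u(k))$ with $(h^0_k)\in\ell^2(\mathbb{N}_0)$; put $m_0(\xi)=q^{-1/2}\sum_kh^0_k\overline{\chi_k(\xi)}$, so $\hat\varphi(\xi)=m_0(\mathfrak{p}\xi)\hat\varphi(\mathfrak{p}\xi)$. It is assumed that functions $m_l(\xi)=q^{-1/2}\sum_{k\in\mathbb{N}_0}h^l_k\overline{\chi_k(\xi)}$, $1\le l\le q-1$, with $(h^l_k)_k\in\ell^2(\mathbb{N}_0)$, are given (they are integral-periodic, i.e. invariant under translation by every $u(k)$) such that the matrix $\bigl(m_l(\mathfrak{p}\xi+\mathfrak{p}u(k))\bigr)_{l,k=0}^{q-1}$ is unitary for a.e. $\xi$. Wavelet packets: $\omega_0=\varphi$; for $1\le n\le q-1$, $\omega_n=\psi_n$, where $\hat\psi_n(\xi)=m_n(\mathfrak{p}\xi)\hat\varphi(\mathfrak{p}\xi)$; and recursively, for $m\ge0$ and $0\le r\le q-1$, $\omega_{r+qm}(x)=q^{1/2}\sum_{k\in\mathbb{N}_0}h^r_k\,\omega_m(\mathfrak{p}^{-1}x-u(k))$, equivalently $\hat\omega_{r+qm}(\xi)=m_r(\mathfrak{p}\xi)\hat\omega_m(\mathfrak{p}\xi)$. *)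

(* Defs.v *)
From HB Require Import structures.
From mathcomp Require Import all_boot all_order all_algebra spectral complex.
From mathcomp Require Import all_classical all_reals all_analysis.

Set Implicit Arguments.
Unset Strict Implicit.
Unset Printing Implicit Defensive.

Import Order.TTheory GRing.Theory Num.Theory.
Import numFieldNormedType.Exports.

Local Open Scope classical_set_scope.
Local Open Scope ring_scope.

HB.mixin Record TopologicalZmodule_isTopologicalField K
    & Topological K & GRing.Field K := {
  mul_continuous : continuous (fun z : K * K => z.1 * z.2) ;
  inv_continuous : forall x : K, x != 0 -> {for x, continuous (@GRing.inv K)}
}.

#[short(type="topologicalFieldType")]
HB.structure Definition TopologicalField :=
  {K of TopologicalZmodule K & GRing.Field K
      & TopologicalZmodule_isTopologicalField K}.

(* The measurable types of the library are pointed. *)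
#[non_forgetful_inheritance]
HB.instance Definition _ (K : topologicalFieldType) :=
  isPointed.Build K (0 : K).

Definition local_field (K : topologicalFieldType) : Prop :=
  [/\ ~ (forall A : set K, open A),
      totally_disconnected [set: K] &
      locally_compact [set: K]].

Notation borelType K := (g_sigma_algebraType (@open K)).

Section LocalField.
Variables (R : realType) (K : topologicalFieldType).
Variable mu : {measure set (borelType K) -> \bar R}.

(* A local field is second countable, so that such a Borel measure is
   automatically regular. *)
Definition haar_measure : Prop :=
  [/\ forall (a : K) (A : set (borelType K)), measurable A ->
        mu [set a + x | x in (A : set K)] = mu A,
      forall C : set K, compact C -> (mu C < +oo)%E &
      forall U : set K, open U -> U !=set0 -> (0 < mu U)%E].

Definition modulus (abs : K -> R) : Prop :=
  abs 0 = 0 /\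
  forall a : K, a != 0 -> forall A : set (borelType K), measurable A ->
    mu [set a * x | x in (A : set K)] = ((abs a)%:E * mu A)%E.

Definition integers (abs : K -> R) : set K := [set x | abs x <= 1].

Definition max_ideal (abs : K -> R) : set K := [set x | abs x < 1].

(* The integers form a subring of K whose quotient by the maximal ideal is
   isomorphic to GF(q): [red] is the reduction map, relevant on the integers
   only. *)
Definition residue_field (abs : K -> R) (q : nat) : Prop :=
  let D := integers abs in
  [/\ D 1, forall x y, D x -> D y -> D (x - y),
      forall x y, D x -> D y -> D (x * y) &
      exists (F : finFieldType) (red : K -> F),
        [/\ #|F| = q,
            red 1 = 1 /\
            (forall x y, D x -> D y ->
               red (x + y) = red x + red y /\ red (x * y) = red x * red y),
            forall x, D x -> (red x = 0 <-> max_ideal abs x) &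
            forall z : F, exists2 x, D x & red x = z]].

Definition prime_element (abs : K -> R) (varpi : K) : Prop :=
  max_ideal abs varpi /\ forall x, max_ideal abs x -> abs x <= abs varpi.

(* Only [eps 0], ..., [eps c.-1] are relevant.  The coefficients [(a k)%:R]
   range over the prime field of K. *)
Definition residue_basis (abs : K -> R) (p c : nat) (eps : nat -> K) : Prop :=
  [/\ eps 0%N = 1,
      forall k, (k < c)%N -> (integers abs `\` max_ideal abs) (eps k) &
      exists (F : finFieldType) (iota : {rmorphism F -> K}),
        #|F| = (p ^ c)%N /\
        range iota =
          [set x | exists a : nat -> nat, x = \sum_(k < c) (a k)%:R * eps k]].

End LocalField.

Section Translations.
Variables (K : fieldType) (p c : nat) (eps : nat -> K) (varpi : K).

Let q := (p ^ c)%N.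

Definition u_digit (n : nat) : K :=
  (\sum_(k < c) (n %/ p ^ k %% p)%:R * eps k) * varpi^-1.

(* The base-q digits of n of index > n are 0, and [u_digit 0 = 0]. *)
Definition u (n : nat) : K :=
  \sum_(s < n.+1) u_digit (n %/ q ^ s %% q) * varpi^-1 ^+ s.

End Translations.

Section Character.
Variables (R : realType) (K : topologicalFieldType) (abs : K -> R).
Variables (p c : nat) (eps : nat -> K) (varpi : K).

Definition expi (t : R) : R[i] := Complex (cos t) (sin t).

Definition basic_character (chi : K -> R[i]) : Prop :=
  [/\ continuous (chi : K -> R[i]^o),
      forall x y, chi (x + y) = chi x * chi y,
      forall x, `|chi x| = 1,
      forall (k : nat) (j : int), (k < c)%N ->
        chi (eps k * varpi ^ (- j)) =
          if (k == 0%N) && (j == 1) then expi (2 * pi / p%:R) else 1 &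
      forall x, integers abs x -> chi x = 1].

End Character.

(* Square-integrable functions are handled through Borel representatives;
   equality in L^2 is equality almost everywhere. *)
Section L2.
Context d (T : measurableType d) (R : realType).
Variable mu : {measure set T -> \bar R}.
Implicit Types (f g : T -> R[i]) (V W : set (T -> R[i])).

Definition cmeasurable f : Prop :=
  measurable_fun setT (fun x => complex.Re (f x)) /\
  measurable_fun setT (fun x => complex.Im (f x)).

Definition cnorm (r : R) f : \bar R :=
  Lnorm mu r%:E (fun x => (Normc.normc (f x))%:E).

Definition L1 : set (T -> R[i]) :=
  [set f | cmeasurable f /\ (cnorm 1 f < +oo)%E].

Definition L2 : set (T -> R[i]) :=
  [set f | cmeasurable f /\ (cnorm 2 f < +oo)%E].

Definition cintegral f : R[i] :=
  Complex (\int[mu]_x complex.Re (f x)) (\int[mu]_x complex.Im (f x)).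

Definition inner f g : R[i] := cintegral (fun x => f x * (g x)^*).

Definition cvgL2 (F : nat -> T -> R[i]) f : Prop :=
  [/\ forall n, L2 (F n), L2 f &
      cnorm 2 (fun x => F n x - f x) @[n --> \oo] --> 0%E].

(* The last clause also makes V stable under almost everywhere equality. *)
Definition closed_subspace V : Prop :=
  [/\ V `<=` L2, V (fun=> 0),
      forall (a : R[i]) f g, V f -> V g -> V (fun x => a * f x + g x) &
      forall F f, (forall n, V (F n)) -> cvgL2 F f -> V f].

Definition dense_in_L2 (S : set (T -> R[i])) : Prop :=
  forall f, L2 f -> forall e : R, 0 < e ->
    exists2 g, S g & (cnorm 2 (fun x => f x - g x)%R < e%:E)%E.

(* W (-) V *)
Definition ominus W V : set (T -> R[i]) :=
  [set f | W f /\ forall g, V g -> inner f g = 0].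

(* The family [e] is indexed by the elements of [A]. *)
Definition orthonormal_basis (I : eqType) (A : set I) (e : I -> T -> R[i])
    V : Prop :=
  [/\ forall i, A i -> V (e i),
      forall i j, A i -> A j -> inner (e i) (e j) = (i == j)%:R &
      forall f, V f -> forall eta : R, 0 < eta ->
        exists (s : seq I) (a : I -> R[i]),
          (forall i, i \in s -> A i) /\
          (cnorm 2 (fun x => f x - \sum_(i <- s) a i * e i x)%R < eta%:E)%E].

End L2.

Section MRA.
Variables (R : realType) (K : topologicalFieldType).
Variable mu : {measure set (borelType K) -> \bar R}.
Variables (abs : K -> R) (q : nat) (varpi : K) (u : nat -> K).
Variable chi : K -> R[i].

Definition translates (f : K -> R[i]) (k : nat) : K -> R[i] :=
  fun x => f (x - u k).

Definition MRA (V : int -> set (K -> R[i])) (phi : K -> R[i]) : Prop :=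
  (forall j, closed_subspace mu (V j)) /\
  [/\ forall j, V j `<=` V (j + 1),
      dense_in_L2 mu (\bigcup_j V j) /\
      (forall f, (forall j, V j f) -> {ae mu, forall x, f x = 0}),
      forall j f, V j f <-> V (j + 1) (fun x => f (varpi^-1 * x)) &
      V 0 phi /\ orthonormal_basis mu setT (translates phi) (V 0)].

Definition ell2 (h : nat -> R[i]) : Prop :=
  (\sum_(0 <= k <oo) ((Normc.normc (h k)) ^+ 2)%:E < +oo :> \bar R)%E.

(* g(x) = q^(1/2) \sum_k h_k f(varpi^-1 x - u(k)), the series converging in
   L^2(K). *)
Definition refinement (h : nat -> R[i]) (f g : K -> R[i]) : Prop :=
  cvgL2 mu (fun n x => sqrtC q%:R *
              \sum_(k < n) h k * f (varpi^-1 * x - u k)) g.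

(* m(xi) = q^(-1/2) \sum_k h_k \overline{chi(u(k) xi)}.  For h in l^2 the
   series converges in L^2 on every coset of the integers, and this defines
   m almost everywhere on K; since chi(u(j) u(k)) = 1, the function m is
   integral-periodic. *)
Definition symbol (h : nat -> R[i]) (m : K -> R[i]) : Prop :=
  forall a : K, let B := [set a + x | x in integers abs] in
  cvgL2 mu
    (fun n => patch (fun=> 0) B (fun xi => (sqrtC q%:R)^-1 *
                \sum_(k < n) h k * (chi (u k * xi))^*))
    (patch (fun=> 0) B m).

Definition fourierL1 (f : K -> R[i]) (xi : K) : R[i] :=
  cintegral mu (fun x => f x * (chi (xi * x))^*).

(* g is the Fourier transform of f in L^2(K), by continuous extension from
   L^1 `&` L^2. *)
Definition fourierL2 (f g : K -> R[i]) : Prop :=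
  exists F : nat -> K -> R[i],
    [/\ forall n, L1 mu (F n), cvgL2 mu F f &
        cvgL2 mu (fun n => fourierL1 (F n)) g].

Definition unitary_filters (m : nat -> K -> R[i]) : Prop :=
  {ae mu, forall xi : K,
    (\matrix_(l < q, k < q) m l (varpi * xi + varpi * u k)) \is unitarymx}.

Definition wavelet_packets (phi : K -> R[i]) (h : nat -> nat -> R[i])
    (m : nat -> K -> R[i]) (omega : nat -> K -> R[i]) : Prop :=
  [/\ omega 0%N = phi,
      exists2 phihat, fourierL2 phi phihat &
        forall n, (1 <= n <= q - 1)%N ->
          fourierL2 (omega n) (fun xi => m n (varpi * xi) * phihat (varpi * xi)) &
      forall n r, (r <= q - 1)%N ->
        refinement (h r) (omega n) (omega (r + q * n)%N)].

End MRA.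

(* Main.v *)
Require Import Defs.
From mathcomp Require Import all_boot all_order all_algebra complex finfield spectral.
From mathcomp Require Import all_classical all_reals all_analysis.
From mathcomp Require Import measurable_realfun.
From mathcomp Require Import ring lra.

(** The packets of one scale arise from those of the previous scale by a single
splitting step, and the theorem is an induction on that step.

If the functions [omega_n(x - u(k))] with [n < q^j] form an orthonormal basis
of [V_j], then the functions [e_(n,k)(x) = q^(1/2) omega_n(varpi^-1 x - u(k))]
form one of [V_(j+1)], because the dilation by [varpi^-1] maps [V_j] onto
[V_(j+1)] and divides squared norms by [q] ([dilation_orthonormal_basis]).  The
elements [u(k)] form a subgroup of [K] that contains [varpi^-1 u(l) = u(q l)].
Translating the refinement equation by [u(l)] therefore only permutes indices:
[omega_(r + q n)(x - u(l))] is the sum over [k] of [h^r_k e_(n, tau l k)], where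
[u(tau l k) = u(k) + varpi^-1 u(l)].

Orthonormality of the new family.  The inner product of two such series is a
limit of double sums of [h^r_k conj(h^r'_k')] over the pairs [k, k'] with
[tau l k = tau l' k'].  The characters [conj(chi(u(k) x))] being orthonormal on
the ring of integers, the same double sums, up to a factor [q], have as limit
the integral over the integers of [m_r conj(m_r')] times a character.  The
integers are the disjoint union of [q] cosets of the maximal ideal, each an
affine image of the integers, so that this integral becomes the integral of an
entry of [M M^* = 1] against a character: this is [gram].

Completeness of the new family is a counting argument ([splitting_complete]).
Fix [n] and [j] and choose [q] indices [J_i] with [u(J_i) = u(j) + u(i)].  As
[i] and [l] vary, the inner products of [e_(n,J_i)] with
[omega_(r + q n)(x - u(l))] run over all the conjugates of the [h^r_k].  Their
squared moduli, summed over [i], [r] and [l], thus give the sum over [r] of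
[||h^r||^2 = 1], which is [q].  By Bessel's inequality each of the [q] values
of [i] contributes at most 1, hence exactly 1, and [e_(n,j) = e_(n,J_0)] lies in
the closed span of the new family.

This gives the basis of [V_j].  For [W_j], the packets with
[q^j <= n < q^(j+1)] are orthogonal to the basis of [V_j], and removing the
other terms from an approximation of a vector orthogonal to [V_j] can only
improve it.  The basis of [L^2(K)] follows from the density of the union of the
[V_j].

The arithmetic of [K] enters through three facts: the ring of integers is open
([near_integers]), it is cut into [q] cosets of [varpi] times itself
([coset_cover]), whence [|varpi| = 1/q], and [chi] separates the elements
[u(n)] ([u_separated]). *)

Set Implicit Arguments.
Unset Strict Implicit.
Unset Printing Implicit Defensive.

Import Order.TTheory GRing.Theory Num.Theory.
Import numFieldNormedType.Exports.

Local Open Scope classical_set_scope.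
Local Open Scope ring_scope.

(** * Complex numbers and complex integrals *)

Section ComplexParts.
Variable R : realType.
Implicit Types z w : R[i].

Lemma cReD z w : complex.Re (z + w) = complex.Re z + complex.Re w.
Proof. by case: z w => ? ? [? ?]. Qed.
Lemma cImD z w : complex.Im (z + w) = complex.Im z + complex.Im w.
Proof. by case: z w => ? ? [? ?]. Qed.
Lemma cReM z w : complex.Re (z * w) =
  complex.Re z * complex.Re w - complex.Im z * complex.Im w.
Proof. by case: z w => ? ? [? ?]. Qed.
Lemma cImM z w : complex.Im (z * w) =
  complex.Re z * complex.Im w + complex.Im z * complex.Re w.
Proof. by case: z w => ? ? [? ?]. Qed.
Lemma cReC z : complex.Re z^* = complex.Re z.
Proof. by case: z. Qed.
Lemma cImC z : complex.Im z^* = - complex.Im z.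
Proof. by case: z. Qed.
Lemma complexP z w : complex.Re z = complex.Re w ->
  complex.Im z = complex.Im w -> z = w.
Proof. by case: z w => ? ? [? ?] /= -> ->. Qed.

(** The squared modulus as a real number, so that limits and estimates are real. *)
Definition sqc z : R := complex.Re z ^+ 2 + complex.Im z ^+ 2.

Lemma sqc_ge0 z : 0 <= sqc z.
Proof. by rewrite addr_ge0 ?sqr_ge0. Qed.

Lemma sqc_normc z : sqc z = Normc.normc z ^+ 2.
Proof. by case: z => a b; rewrite /sqc /= sqr_sqrtr// addr_ge0 ?sqr_ge0. Qed.

Lemma sqcE z : (real_complex R (sqc z)) = z * z^*.
Proof.
apply: complexP; rewrite ?cReM ?cImM cReC cImC /sqc /=; ring.
Qed.

Lemma sqcM z w : sqc (z * w) = sqc z * sqc w.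
Proof. rewrite /sqc cReM cImM; ring. Qed.

Lemma sqcC z : sqc z^* = sqc z.
Proof. by rewrite /sqc cReC cImC sqrrN. Qed.

Lemma sqc0 : sqc 0 = 0.
Proof. by rewrite /sqc /= !expr0n /= addr0. Qed.

Lemma sqc_eq0 z : sqc z = 0 -> z = 0.
Proof.
move=> /eqP; rewrite paddr_eq0 ?sqr_ge0// !sqrf_eq0 => /andP[/eqP a /eqP b].
exact: complexP.
Qed.

Lemma sqcD_le z w : sqc (z + w) <= 2 * (sqc z + sqc w).
Proof.
rewrite /sqc cReD cImD.
have := sqr_ge0 (complex.Re z - complex.Re w).
have := sqr_ge0 (complex.Im z - complex.Im w).
nra.
Qed.

End ComplexParts.

Section ComplexIntegral.
Context d (T : measurableType d) (R : realType).
Variable mu : {measure set T -> \bar R}.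
Implicit Types f g : T -> R[i].

Lemma cmeasurable_cst (a : R[i]) : cmeasurable (fun _ : T => a).
Proof. by split; exact: measurable_cst. Qed.

Lemma cmeasurableD f g : cmeasurable f -> cmeasurable g ->
  cmeasurable (fun x => f x + g x).
Proof.
move=> [f1 f2] [g1 g2]; split.
- under eq_fun do rewrite cReD; exact: measurable_funD.
- under eq_fun do rewrite cImD; exact: measurable_funD.
Qed.

Lemma cmeasurableM f g : cmeasurable f -> cmeasurable g ->
  cmeasurable (fun x => f x * g x).
Proof.
move=> [f1 f2] [g1 g2]; split.
- by under eq_fun do rewrite cReM; apply: measurable_funB; apply: measurable_funM.
- by under eq_fun do rewrite cImM; apply: measurable_funD; apply: measurable_funM.
Qed.

Lemma cmeasurableC f : cmeasurable f -> cmeasurable (fun x => (f x)^*).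
Proof.
move=> [f1 f2]; split.
- by under eq_fun do rewrite cReC.
- under eq_fun do rewrite cImC; exact: measurableT_comp.
Qed.

Definition cintegrable f :=
  mu.-integrable setT (fun x => (complex.Re (f x))%:E) /\
  mu.-integrable setT (fun x => (complex.Im (f x))%:E).

Lemma cintegrable_meas f : cintegrable f -> cmeasurable f.
Proof.
by move=> [/measurable_int/measurable_EFinP ? /measurable_int/measurable_EFinP ?].
Qed.

Lemma cintegrableD f g : cintegrable f -> cintegrable g ->
  cintegrable (fun x => f x + g x).
Proof.
move=> [f1 f2] [g1 g2]; split.
- by under eq_fun do rewrite cReD EFinD; exact: integrableD.
- by under eq_fun do rewrite cImD EFinD; exact: integrableD.
Qed.

Lemma cintegrableZ a f : cintegrable f -> cintegrable (fun x => a * f x).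
Proof.
move=> [f1 f2]; split.
- under eq_fun do rewrite cReM EFinB !EFinM.
  by apply: integrableB => //; exact: integrableZl.
- under eq_fun do rewrite cImM EFinD !EFinM.
  by apply: integrableD => //; exact: integrableZl.
Qed.

Lemma cintegral_ext f g : f =1 g -> cintegral mu f = cintegral mu g.
Proof. by move=> /funext ->. Qed.

Lemma cintegralD f g : cintegrable f -> cintegrable g ->
  cintegral mu (fun x => f x + g x) = cintegral mu f + cintegral mu g.
Proof.
move=> [f1 f2] [g1 g2]; apply: complexP; rewrite ?cReD ?cImD /=.
- by under eq_Rintegral do rewrite cReD; rewrite RintegralD.
- by under eq_Rintegral do rewrite cImD; rewrite RintegralD.
Qed.

Lemma cintegralZ a f : cintegrable f ->
  cintegral mu (fun x => a * f x) = a * cintegral mu f.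
Proof.
move=> [f1 f2]; apply: complexP; rewrite ?cReM ?cImM /=.
- under eq_Rintegral do rewrite cReM.
  rewrite RintegralB//; last 2 first.
  + exact: (integrableZl measurableT _ f1).
  + exact: (integrableZl measurableT _ f2).
  by rewrite !RintegralZl.
- under eq_Rintegral do rewrite cImM.
  rewrite RintegralD//; last 2 first.
  + exact: (integrableZl measurableT _ f2).
  + exact: (integrableZl measurableT _ f1).
  by rewrite !RintegralZl.
Qed.

Lemma cintegralC f : cintegrable f ->
  cintegral mu (fun x => (f x)^*) = (cintegral mu f)^*.
Proof.
move=> [f1 f2]; apply: complexP; rewrite ?cReC ?cImC /=.
- by under eq_Rintegral do rewrite cReC.
- under eq_Rintegral do rewrite cImC -mulN1r.
  by rewrite RintegralZl// mulN1r.
Qed.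

Lemma cintegrable0 : cintegrable (fun=> 0).
Proof. by split; exact: integrable0. Qed.

Lemma cintegral0 : cintegral mu (fun=> 0) = 0.
Proof. by rewrite /cintegral /= !Rintegral_cst// !mul0r. Qed.

Lemma cintegrable_sum (I : Type) (s : seq I) (F : I -> T -> R[i]) :
  (forall i, cintegrable (F i)) -> cintegrable (fun x => \sum_(i <- s) F i x).
Proof.
move=> Fi; elim: s => [|i s IH].
  by under eq_fun do rewrite big_nil; exact: cintegrable0.
by under eq_fun do rewrite big_cons; exact: cintegrableD.
Qed.

Lemma cintegral_sum (I : Type) (s : seq I) (F : I -> T -> R[i]) :
  (forall i, cintegrable (F i)) ->
  cintegral mu (fun x => \sum_(i <- s) F i x) = \sum_(i <- s) cintegral mu (F i).
Proof.
move=> Fi; elim: s => [|i s IH].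
  rewrite big_nil -[RHS]cintegral0; apply: cintegral_ext => x.
  by rewrite big_nil.
rewrite big_cons -IH -cintegralD//; last exact: cintegrable_sum.
by apply: cintegral_ext => x; rewrite big_cons.
Qed.

Lemma cintegral_ae f g : cmeasurable f -> cmeasurable g ->
  {ae mu, forall x, f x = g x} -> cintegral mu f = cintegral mu g.
Proof.
move=> [f1 f2] [g1 g2] fg; apply: complexP => /=; rewrite /Rintegral;
  congr fine; apply: ae_eq_integral => //; try exact/measurable_EFinP;
  by apply: filterS fg => x -> _.
Qed.

End ComplexIntegral.

(** * The Hermitian form on square-integrable functions *)

Section L2Space.
Context d (T : measurableType d) (R : realType).
Variable mu : {measure set T -> \bar R}.
Implicit Types f g k : T -> R[i].
Local Notation "''[' f , g ]" := (inner mu f g).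
Local Notation L2 := (L2 mu).

Lemma measurable_sqc f : cmeasurable f -> measurable_fun setT (fun x => sqc (f x)).
Proof.
by move=> [f1 f2]; apply: measurable_funD; apply: measurable_funX.
Qed.

Lemma cnorm2E f : cnorm mu 2 f = ((\int[mu]_x (sqc (f x))%:E) `^ 2^-1)%E.
Proof.
rewrite /cnorm unlock; congr (_ `^ _)%E; apply: eq_integral => x _.
by rewrite abse_EFin poweR_EFin powR_mulrn// real_normK ?num_real// -sqc_normc.
Qed.

Lemma L2P f : L2 f <->
  cmeasurable f /\ mu.-integrable setT (fun x => (sqc (f x))%:E).
Proof.
have E : (\int[mu]_x `|(sqc (f x))%:E| = \int[mu]_x (sqc (f x))%:E)%E.
  by apply: eq_integral => x _; rewrite abse_EFin ger0_norm ?sqc_ge0.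
rewrite /Defs.L2 /= cnorm2E; split=> -[mf fi]; split=> //.
- apply/integrableP; split; first exact/measurable_EFinP/measurable_sqc.
  by rewrite E; apply: lty_poweRy fi; rewrite invr_eq0 pnatr_eq0.
- move/integrableP : fi => [_]; rewrite E => fi.
  by rewrite poweR_lty.
Qed.

Lemma L20 : L2 (fun=> 0).
Proof.
apply/L2P; split; first exact: cmeasurable_cst.
by under eq_fun do rewrite sqc0; exact: integrable0.
Qed.

Lemma L2D f g : L2 f -> L2 g -> L2 (fun x => f x + g x).
Proof.
move=> /L2P[mf fi] /L2P[mg gi]; apply/L2P; split; first exact: cmeasurableD.
apply: (@le_integrable _ _ _ _ _ _ _
   (fun x => 2%:E * ((sqc (f x))%:E + (sqc (g x))%:E))%E) => //.
- exact/measurable_EFinP/measurable_sqc/cmeasurableD.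
- move=> x _; rewrite -EFinD -EFinM !abse_EFin lee_fin.
  rewrite !ger0_norm ?sqc_ge0//; first exact: sqcD_le.
  by apply: mulr_ge0 => //; apply: addr_ge0; exact: sqc_ge0.
- exact: (integrableZl measurableT 2 (integrableD measurableT fi gi)).
Qed.

Lemma L2Z a f : L2 f -> L2 (fun x => a * f x).
Proof.
move=> /L2P[mf fi]; apply/L2P; split.
  by apply: cmeasurableM => //; exact: cmeasurable_cst.
by under eq_fun do rewrite sqcM EFinM; exact: (integrableZl measurableT _ fi).
Qed.

Lemma L2B f g : L2 f -> L2 g -> L2 (fun x => f x - g x).
Proof.
move=> Lf /(L2Z (-1)) Lg.
by under eq_fun do rewrite -mulN1r; exact: L2D.
Qed.

Lemma L2_sum (I : eqType) (s : seq I) (a : I -> R[i]) (F : I -> T -> R[i]) :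
  (forall i, i \in s -> L2 (F i)) -> L2 (fun x => \sum_(i <- s) a i * F i x).
Proof.
elim: s => [|i s IH] Fi.
  by under eq_fun do rewrite big_nil; exact: L20.
under eq_fun do rewrite big_cons; apply: L2D.
  by apply/L2Z/Fi; rewrite mem_head.
by apply: IH => j js; apply: Fi; rewrite inE js orbT.
Qed.

Lemma L2_mul_unimodular f g : L2 f -> cmeasurable g -> (forall x, sqc (g x) = 1) ->
  L2 (fun x => f x * g x).
Proof.
move=> /L2P[mf fi] mg g1; apply/L2P; split; first exact: cmeasurableM.
by under eq_fun do rewrite sqcM g1 mulr1.
Qed.

(** Since [2 |a b| <= |a|^2 + |b|^2], the product is dominated by the integrable
function [|f|^2 + |g|^2]. *)
Lemma cintegrable_inner f g : L2 f -> L2 g -> cintegrable mu (fun x => f x * (g x)^*).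
Proof.
move=> /L2P[mf fi] /L2P[mg gi].
have [m1 m2] := cmeasurableM mf (cmeasurableC mg).
have S : mu.-integrable setT (fun x => (sqc (f x))%:E + (sqc (g x))%:E)%E.
  exact: integrableD.
split; apply: le_integrable S => //; try exact/measurable_EFinP;
  move=> x _; rewrite -EFinD !abse_EFin lee_fin.
- rewrite cReM cReC cImC ler_norml ger0_norm; last by apply: addr_ge0; exact: sqc_ge0.
  case: (f x) (g x) => a b [a' b']; rewrite /sqc/=.
  have := sqr_ge0 (a - a'); have := sqr_ge0 (a + a').
  have := sqr_ge0 (b - b'); have := sqr_ge0 (b + b').
  by move=> *; apply/andP; split; nra.
- rewrite cImM cReC cImC ler_norml ger0_norm; last by apply: addr_ge0; exact: sqc_ge0.
  case: (f x) (g x) => a b [a' b']; rewrite /sqc/=.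
  have := sqr_ge0 (a - b'); have := sqr_ge0 (a + b').
  have := sqr_ge0 (b - a'); have := sqr_ge0 (b + a').
  by move=> *; apply/andP; split; nra.
Qed.

Lemma innerDl f g k : L2 f -> L2 g -> L2 k ->
  '[(fun x => f x + g x), k] = '[f, k] + '[g, k].
Proof.
move=> Lf Lg Lk; rewrite /inner -cintegralD; try exact: cintegrable_inner.
by apply: cintegral_ext => x; rewrite mulrDl.
Qed.

Lemma innerZl a f k : L2 f -> L2 k ->
  '[(fun x => a * f x), k] = a * '[f, k].
Proof.
move=> Lf Lk; rewrite /inner -cintegralZ; try exact: cintegrable_inner.
by apply: cintegral_ext => x; rewrite mulrA.
Qed.

Lemma innerC f g : L2 f -> L2 g -> '[g, f] = '[f, g]^*.
Proof.
move=> Lf Lg; rewrite /inner -cintegralC; last exact: cintegrable_inner.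
by apply: cintegral_ext => x; rewrite rmorphM /= conjCK mulrC.
Qed.

Lemma innerZr a f k : L2 f -> L2 k ->
  '[k, (fun x => a * f x)] = a^* * '[k, f].
Proof.
move=> Lf Lk; rewrite innerC//; last exact: L2Z.
by rewrite innerZl// rmorphM /= -!innerC.
Qed.

Lemma innerBl f g k : L2 f -> L2 g -> L2 k ->
  '[(fun x => f x - g x), k] = '[f, k] - '[g, k].
Proof.
move=> Lf Lg Lk; rewrite -mulN1r -innerZl// -innerDl//; last exact: L2Z.
by congr inner; apply/funext => x; rewrite mulN1r.
Qed.

Lemma innerBr f g k : L2 f -> L2 g -> L2 k ->
  '[k, (fun x => f x - g x)] = '[k, f] - '[k, g].
Proof.
move=> Lf Lg Lk; rewrite innerC//; last exact: L2B.
by rewrite innerBl// rmorphB /= -!innerC.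
Qed.

Lemma inner0l k : '[(fun=> 0), k] = 0.
Proof.
by rewrite /inner; under cintegral_ext do rewrite mul0r; exact: cintegral0.
Qed.

Lemma inner_suml (I : eqType) (s : seq I) (a : I -> R[i]) (F : I -> T -> R[i]) k :
  (forall i, i \in s -> L2 (F i)) -> L2 k ->
  '[(fun x => \sum_(i <- s) a i * F i x), k] = \sum_(i <- s) a i * '[F i, k].
Proof.
move=> + Lk; elim: s => [|i s IH] Fi.
  by rewrite big_nil -[RHS](inner0l k); congr inner; apply/funext=> x; rewrite big_nil.
have Fs j : j \in s -> L2 (F j) by move=> js; apply: Fi; rewrite inE js orbT.
have Fi' : L2 (F i) by apply: Fi; rewrite mem_head.
rewrite big_cons -IH// -innerZl// -innerDl//; last 2 first.
- exact: L2Z.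
- exact: L2_sum.
by congr inner; apply/funext=> x; rewrite big_cons.
Qed.

Lemma inner_sumr (I : eqType) (s : seq I) (a : I -> R[i]) (F : I -> T -> R[i]) k :
  (forall i, i \in s -> L2 (F i)) -> L2 k ->
  '[k, (fun x => \sum_(i <- s) a i * F i x)] = \sum_(i <- s) (a i)^* * '[k, F i].
Proof.
move=> Fi Lk; rewrite innerC//; last exact: L2_sum.
rewrite inner_suml// rmorph_sum /= !big_seq; apply: eq_bigr => i /Fi Li.
by rewrite rmorphM /= -innerC.
Qed.

Definition sqnorm f : R := \int[mu]_x (sqc (f x)).
Local Notation sqn := sqnorm.

Lemma sqnormE f : (real_complex R (sqn f)) = '[f, f].
Proof.
apply: complexP => /=; rewrite /sqnorm.
- by under [RHS]eq_Rintegral do rewrite -sqcE.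
- under eq_Rintegral do rewrite -sqcE /=.
  by rewrite Rintegral_cst// mul0r.
Qed.

Lemma sqnorm_ge0 f : 0 <= sqn f.
Proof. by apply: Rintegral_ge0 => x _; exact: sqc_ge0. Qed.

Lemma cnorm_sqnorm f : L2 f -> cnorm mu 2 f = (Num.sqrt (sqn f))%:E.
Proof.
move=> /L2P[mf fi]; rewrite cnorm2E -powR12_sqrt ?sqnorm_ge0//.
by rewrite -poweR_EFin /sqnorm /Rintegral fineK//; exact: integrable_fin_num.
Qed.

Lemma cnorm_lt f (e : R) : L2 f -> 0 < e -> (cnorm mu 2 f < e%:E)%E = (sqn f < e ^+ 2).
Proof.
move=> Lf e0; rewrite cnorm_sqnorm// lte_fin.
by rewrite -{1}(gtr0_norm e0) -sqrtr_sqr ltr_sqrt// exprn_gt0.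
Qed.

Lemma sqnormZ a f : L2 f -> sqn (fun x => a * f x) = sqc a * sqn f.
Proof.
move=> Lf; apply: (@complexI R); rewrite rmorphM /= sqcE !sqnormE.
rewrite innerZl ?innerZr//; last exact: L2Z.
by rewrite mulrA.
Qed.

Lemma sqnormD_le f g : L2 f -> L2 g -> sqn (fun x => f x + g x) <= 2 * (sqn f + sqn g).
Proof.
move=> Lf Lg; have := L2D Lf Lg; move: Lf Lg => /L2P[mf fi] /L2P[mg gi] /L2P[mfg fgi].
rewrite /sqnorm -RintegralD// -RintegralZl//; last first.
  exact: (integrableD measurableT fi gi).
apply: le_Rintegral => //.
  exact: (integrableZl measurableT 2 (integrableD measurableT fi gi)).
by move=> x _; exact: sqcD_le.
Qed.

Lemma sqnormB f g : L2 f -> L2 g ->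
  sqn (fun x => f x - g x) = sqn f - 2 * complex.Re '[f, g] + sqn g.
Proof.
move=> Lf Lg; apply: (@complexI R).
have LB := L2B Lf Lg.
rewrite sqnormE innerBl// !innerBr// (innerC Lf Lg) -!sqnormE.
apply: complexP; rewrite ?(cReD,cImD) /=; case: '[f, g] => a b /=; ring.
Qed.

(** The form is only semi-definite, so [g] cannot always be normalised.
With [b = <f, g>], the real quadratic polynomial
[s |-> ||f - s b g||^2] is nonnegative for every [s].  Taking [s = 1 / ||g||^2]
gives the inequality; if [||g|| = 0] the polynomial is affine in [s] and [b]
must vanish. *)
Lemma Cauchy_Schwarz f g : L2 f -> L2 g -> sqc '[f, g] <= sqn f * sqn g.
Proof.
move=> Lf Lg; set B := sqc _; set b := '[f, g].
have P (s : R) : 0 <= sqn f - 2 * s * B + s ^+ 2 * B * sqn g.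
  have := sqnorm_ge0 (fun x => f x - (s%:C%C * b) * g x).
  rewrite sqnormB//; last exact: L2Z.
  rewrite sqnormZ// innerZr// sqcM.
  have ReZ (z : R[i]) : complex.Re ((s%:C%C * z)^* * z) = s * sqc z.
    by rewrite cReM cReC cImC cReM cImM /= /sqc; ring.
  rewrite ReZ -/B; have -> : sqc s%:C%C = s ^+ 2 by rewrite /sqc /= expr0n addr0.
  by rewrite mulrA.
have B0 : 0 <= B by exact: sqc_ge0.
have [g0|/eqP g0] := eqVneq (sqn g) 0.
  rewrite g0 mulr0 leNgt; apply/negP => Bp.
  have := P ((sqn f + 1) / (2 * B)); rewrite g0 mulr0 addr0.
  have -> : 2 * ((sqn f + 1) / (2 * B)) * B = sqn f + 1 by field; rewrite gt_eqF.
  by lra.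
have gp : 0 < sqn g by rewrite lt_def sqnorm_ge0 andbT; apply/eqP.
have := P (sqn g)^-1.
have -> : (sqn g)^-1 ^+ 2 * B * sqn g = B / sqn g by field; exact/eqP.
have -> : 2 * (sqn g)^-1 * B = 2 * (B / sqn g) by ring.
move=> H; rewrite -ler_pdivrMr//; lra.
Qed.

End L2Space.

(** * Limits of inner products *)

Section ComplexConvergence.
Variable R : realType.
Implicit Types (z w : nat -> R[i]) (a b c : R[i]).

(** Convergence of complex sequences, expressed by a real limit. *)
Definition ccvg z a := sqc (z n - a) @[n --> \oo] --> (0 : R).

Lemma ccvg_unique z a b : ccvg z a -> ccvg z b -> a = b.
Proof.
move=> za zb; apply/eqP; rewrite -subr_eq0; apply/eqP/sqc_eq0/eqP.
rewrite eq_le sqc_ge0 andbT.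
have : (2 * (sqc (z n - a) + sqc (z n - b))) @[n --> \oo] --> (0 : R).
  by rewrite -(mulr0 2) -(addr0 0); apply: cvgM; [exact: cvg_cst|exact: cvgD].
move/cvgr_to_ge; apply.
near=> n.
have -> : a - b = - (z n - a) + (z n - b) by ring.
apply: le_trans (sqcD_le _ _) _.
by rewrite (_ : sqc (- (z n - a)) = sqc (z n - a))// -mulN1r sqcM /sqc /=
  oppr0 expr0n sqrrN expr1n addr0 mul1r.
Unshelve. all: by end_near. Qed.

Lemma ccvg_near z w a : (\forall n \near \oo, z n = w n) -> ccvg z a -> ccvg w a.
Proof.
move=> zw; apply: cvg_trans; apply: near_eq_cvg.
by apply: filterS zw => n ->.
Qed.

Lemma ccvg_cst a : ccvg (fun=> a) a.
Proof. by rewrite /ccvg subrr sqc0; exact: cvg_cst. Qed.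

Lemma ccvgZ c z a : ccvg z a -> ccvg (fun n => c * z n) (c * a).
Proof.
move=> za; rewrite /ccvg -(mulr0 (sqc c)).
under eq_fun do rewrite -mulrBr sqcM.
by apply: cvgM => //; exact: cvg_cst.
Qed.

End ComplexConvergence.

Section L2Convergence.
Context d (T : measurableType d) (R : realType).
Variable mu : {measure set T -> \bar R}.
Implicit Types f g : T -> R[i].
Local Notation L2 := (L2 mu).
Local Notation sqn := (sqnorm mu).

Lemma cvgL2P (F : nat -> T -> R[i]) f : cvgL2 mu F f <->
  [/\ forall n, L2 (F n), L2 f & sqn (fun x => F n x - f x) @[n --> \oo] --> (0 : R)].
Proof.
split=> -[LF Lf Ff]; split => //.
- have : (fun n => (Num.sqrt (sqn (fun x => F n x - f x)))%:E) @ \oo --> 0%:E.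
    apply: cvg_trans Ff; apply: near_eq_cvg; near=> n.
    by rewrite cnorm_sqnorm//; exact: L2B.
  move/fine_cvg => /= H.
  rewrite (_ : (fun n => _) = (fun n => Num.sqrt (sqn (fun x => F n x - f x)) *
      Num.sqrt (sqn (fun x => F n x - f x)))); last first.
    by apply/funext => n; rewrite -expr2 sqr_sqrtr// sqnorm_ge0.
  by rewrite -(mulr0 0); exact: cvgM.
- have : (Num.sqrt (sqn (fun x => F n x - f x)))%:E @[n --> \oo] --> 0%:E.
    apply: cvg_EFin; first by exists 0%N.
    rewrite -[X in _ --> X]sqrtr0 /=.
    exact: (continuous_cvg _ (@sqrt_continuous R 0) Ff).
  apply: cvg_trans; apply: near_eq_cvg; near=> n.
  by rewrite cnorm_sqnorm//; exact: L2B.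
Unshelve. all: by end_near. Qed.

(** [<F_n, G_n> - <f, g> = <F_n - f, G_n> + <f, G_n - g>], and both terms tend to
0 by the Cauchy-Schwarz inequality. *)
Lemma inner_cvg (F G : nat -> T -> R[i]) f g : cvgL2 mu F f -> cvgL2 mu G g ->
  ccvg (fun n => inner mu (F n) (G n)) (inner mu f g).
Proof.
move=> /cvgL2P[LF Lf Ff] /cvgL2P[LG Lg Gg].
pose a n := sqn (fun x => F n x - f x); pose b n := sqn (fun x => G n x - g x).
apply: (@squeeze_cvgr _ _ _ _ (fun=> 0)
  (fun n => 2 * (a n * (2 * (b n + sqn g)) + sqn f * b n))).
- near=> n; rewrite sqc_ge0 /=.
  have LFf := L2B (LF n) Lf; have LGg := L2B (LG n) Lg.
  have -> : inner mu (F n) (G n) - inner mu f g =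
     inner mu (fun x => F n x - f x) (G n) + inner mu f (fun x => G n x - g x).
    by rewrite innerBl// innerBr//; ring.
  apply: le_trans (sqcD_le _ _) _; rewrite ler_pM2l// lerD//.
    apply: le_trans (Cauchy_Schwarz LFf (LG n)) _.
    apply: ler_wpM2l; first exact: sqnorm_ge0.
    have -> : G n = (fun x => (G n x - g x) + g x) by apply/funext => x; rewrite subrK.
    exact: (sqnormD_le LGg Lg).
  exact: Cauchy_Schwarz.
- exact: cvg_cst.
- have -> : 0 = 2 * (0 * (2 * (0 + sqn g)) + sqn f * 0) by rewrite mul0r mulr0 addr0 mulr0.
  apply: cvgM; first exact: cvg_cst.
  apply: cvgD; apply: cvgM => //; try exact: cvg_cst.
  apply: cvgM; first exact: cvg_cst.
  by apply: cvgD => //; exact: cvg_cst.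
Unshelve. all: by end_near. Qed.

End L2Convergence.

(** * Orthonormal families and closed spans *)

Section OrthonormalFamilies.
Context d (T : measurableType d) (R : realType).
Variable mu : {measure set T -> \bar R}.
Implicit Types f g : T -> R[i].
Local Notation L2 := (L2 mu).
Local Notation sqn := (sqnorm mu).

(** The square-integrability of the members makes the inner products meaningful. *)
Definition orthonormal_on (I : eqType) (A : set I) (e : I -> T -> R[i]) :=
  (forall i, A i -> L2 (e i)) /\
  (forall i j, A i -> A j -> inner mu (e i) (e j) = (i == j)%:R).

(** Finite linear combinations are lists of (coefficient, index) pairs, possibly
with repeated indices: the sum of two combinations is a concatenation. *)
Definition combination (I : Type) (e : I -> T -> R[i]) (l : seq (R[i] * I)) : T -> R[i] :=
  fun x => \sum_(p <- l) p.1 * e p.2 x.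

(** Membership in the closed linear span. *)
Definition in_span (I : eqType) (A : set I) (e : I -> T -> R[i]) f :=
  forall eta : R, 0 < eta -> exists2 l : seq (R[i] * I),
    (forall p, p \in l -> A p.2) & sqn (fun x => f x - combination e l x) < eta.

Lemma L2_combination (I : eqType) (A : set I) (e : I -> T -> R[i]) l :
  (forall i, A i -> L2 (e i)) -> (forall p, p \in l -> A p.2) ->
  L2 (combination e l).
Proof. by move=> Le Al; apply: L2_sum => p /Al; exact: Le. Qed.

(** Grouping the terms by index brings a combination to the form used in the
definition of orthonormal bases. *)
Lemma combination_uniq (I : eqType) (e : I -> T -> R[i]) (l : seq (R[i] * I)) x :
  combination e l x = \sum_(i <- undup (unzip2 l))
    (\sum_(p <- l | p.2 == i) p.1) * e i x.
Proof.
under eq_bigr do rewrite mulr_suml.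
rewrite (exchange_big_dep xpredT)//= /combination !big_seq.
apply: eq_bigr => p pl.
rewrite (eq_bigl (fun i => i == p.2)); last by move=> i; rewrite eq_sym.
by rewrite -big_filter filter_pred1_uniq ?undup_uniq ?mem_undup ?map_f// big_seq1.
Qed.

Lemma in_span_approx (I : eqType) (A : set I) (e : I -> T -> R[i]) f :
  (forall i, A i -> L2 (e i)) -> L2 f ->
  in_span A e f <->
  (forall eta : R, 0 < eta ->
        exists (s : seq I) (a : I -> R[i]),
          (forall i, i \in s -> A i) /\
          (cnorm mu 2 (fun x => f x - \sum_(i <- s) a i * e i x)%R < eta%:E)%E).
Proof.
move=> Le Lf; split=> H eta eta0.
- have [|l Al fl] := H (eta ^+ 2); first by rewrite exprn_gt0.
  exists (undup (unzip2 l)), (fun i => \sum_(p <- l | p.2 == i) p.1); split.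
    by move=> i; rewrite mem_undup => /mapP[p /Al + ->].
  rewrite (_ : (fun x => _) = (fun x => f x - combination e l x)); last first.
    by apply/funext => x; rewrite combination_uniq.
  by rewrite cnorm_lt//; apply: L2B => //; exact: L2_combination Al.
- have [|s [a [As fs]]] := H (Num.sqrt eta); first by rewrite sqrtr_gt0.
  exists [seq (a i, i) | i <- s]; first by move=> p /mapP[i /As + ->].
  move: fs; rewrite cnorm_lt ?sqrtr_gt0//; last first.
    by apply: L2B => //; apply: L2_sum => i /As; exact: Le.
  rewrite sqr_sqrtr; last exact: ltW.
  congr (_ < _); congr sqn; apply/funext => x.
  by rewrite /combination big_map.
Qed.

Lemma in_span_closure (I : eqType) (A : set I) (e : I -> T -> R[i]) f :
  (forall i, A i -> L2 (e i)) -> L2 f ->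
  (forall eta : R, 0 < eta -> exists g, [/\ L2 g, in_span A e g &
    sqn (fun x => f x - g x) < eta]) ->
  in_span A e f.
Proof.
move=> Le Lf H eta eta0.
have eta4 : 0 < eta / 4 by rewrite divr_gt0.
have [g [Lg /(_ _ eta4)[l Al gl] fg]] := H _ eta4.
exists l => //.
have Ll := L2_combination Le Al.
have -> : (fun x => f x - combination e l x) =
          (fun x => (f x - g x) + (g x - combination e l x)).
  by apply/funext => x; ring.
by apply: le_lt_trans (sqnormD_le (L2B Lf Lg) (L2B Lg Ll)) _; lra.
Qed.

Lemma sqnorm0 : sqn (fun=> 0) = 0.
Proof. by rewrite /sqnorm sqc0 Rintegral_cst// mul0r. Qed.

Lemma in_spanDZ (I : eqType) (A : set I) (e : I -> T -> R[i]) a f g :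
  (forall i, A i -> L2 (e i)) -> L2 f -> L2 g ->
  in_span A e f -> in_span A e g -> in_span A e (fun x => a * f x + g x).
Proof.
move=> Le Lf Lg Af Ag eta eta0.
have a0 : 0 < sqc a + 1 by rewrite ltr_wpDl// sqc_ge0.
have [|l Al fl] := Af (eta / 4 / (sqc a + 1)); first by rewrite !divr_gt0.
have [|k Ak gk] := Ag (eta / 4); first by rewrite divr_gt0.
exists ([seq (a * p.1, p.2) | p <- l] ++ k).
  by move=> p; rewrite mem_cat => /orP[/mapP[p' /Al + ->]|/Ak].
have Ll := L2_combination Le Al; have Lk := L2_combination Le Ak.
have -> : (fun x => a * f x + g x - combination e ([seq (a * p.1, p.2) | p <- l] ++ k) x) =
          (fun x => a * (f x - combination e l x) + (g x - combination e k x)).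
  apply/funext => x; rewrite /combination big_cat big_map /=.
  under eq_bigr do rewrite -mulrA.
  by rewrite -mulr_sumr; ring.
apply: le_lt_trans (sqnormD_le (L2Z a (L2B Lf Ll)) (L2B Lg Lk)) _.
rewrite sqnormZ; last exact: L2B.
suff : sqc a * sqn (fun x => f x - combination e l x) <= eta / 4 by lra.
have := ltW fl; rewrite ler_pdivlMr// mulrC; apply: le_trans.
by rewrite ler_wpM2r ?sqnorm_ge0// lerDl.
Qed.

Lemma in_span0 (I : eqType) (A : set I) (e : I -> T -> R[i]) : in_span A e (fun=> 0).
Proof.
move=> eta eta0; exists [::] => //.
rewrite (_ : (fun x => _) = (fun=> 0)) ?sqnorm0//; apply/funext => x.
by rewrite /combination big_nil subrr.
Qed.

Lemma in_span_trans (I J : eqType) (A : set I) (B : set J) (e : I -> T -> R[i])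
    (g : J -> T -> R[i]) f :
  (forall i, A i -> L2 (e i)) -> (forall j, B j -> L2 (g j)) -> L2 f ->
  (forall i, A i -> in_span B g (e i)) -> in_span A e f -> in_span B g f.
Proof.
move=> Le Lg Lf ge Af; apply: in_span_closure => // eta /Af[l Al fl].
exists (combination e l); split => //; first exact: L2_combination Al.
elim: l Al {fl} => [|p l IH] Al.
  rewrite (_ : combination e _ = fun=> 0); first exact: in_span0.
  by apply/funext => x; rewrite /combination big_nil.
rewrite (_ : combination e _ = fun x => p.1 * e p.2 x + combination e l x); last first.
  by apply/funext => x; rewrite /combination big_cons.
have Ap : A p.2 by apply: Al; rewrite mem_head.
have Al' p' : p' \in l -> A p'.2 by move=> H; apply: Al; rewrite inE H orbT.
apply: in_spanDZ => //; [exact: Le|exact: L2_combination Al'|exact: ge|exact: IH].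
Qed.

Section Projection.
Variables (I : eqType) (A : set I) (e : I -> T -> R[i]).
Hypothesis orth : orthonormal_on A e.
Let Le := orth.1.
Let ee := orth.2.

Lemma inner_combination (s : seq I) (a b : I -> R[i]) :
  uniq s -> (forall i, i \in s -> A i) ->
  inner mu (fun x => \sum_(i <- s) a i * e i x) (fun x => \sum_(i <- s) b i * e i x)
  = \sum_(i <- s) a i * (b i)^*.
Proof.
move=> us As; rewrite inner_suml; last 2 first.
- by move=> i /As; exact: Le.
- by apply: L2_sum => i /As; exact: Le.
rewrite !big_seq; apply: eq_bigr => i is_; congr (_ * _).
rewrite inner_sumr; last 2 first.
- by move=> j /As; exact: Le.
- exact/Le/As.
have Ai := As i is_.
rewrite (bigD1_seq i)//= ee// eqxx mulr1 big_seq_cond big1 ?addr0// => j /andP[js ji].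
have Aj := As j js.
by rewrite ee// eq_sym (negbTE ji) mulr0.
Qed.

(** Pythagoras: [f] minus its projection is orthogonal to the projection. *)
Lemma sqnorm_sub_projection f (s : seq I) :
  L2 f -> uniq s -> (forall i, i \in s -> A i) ->
  sqn (fun x => f x - \sum_(i <- s) inner mu f (e i) * e i x) =
  sqn f - \sum_(i <- s) sqc (inner mu f (e i)).
Proof.
move=> Lf us As; rewrite sqnormB//; last by apply: L2_sum => i /As; exact: Le.
have E1 : \sum_(i <- s) inner mu f (e i) * (inner mu f (e i))^* =
    real_complex R (\sum_(i <- s) sqc (inner mu f (e i))).
  by rewrite rmorph_sum /=; apply: eq_bigr => i _; rewrite sqcE.
rewrite inner_sumr//; last by move=> i /As; exact: Le.
under eq_bigr do rewrite mulrC.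
rewrite E1 /=.
have := inner_combination (fun i => inner mu f (e i)) (fun i => inner mu f (e i)) us As.
rewrite -sqnormE E1 => /(@complexI R) ->; ring.
Qed.

Lemma Bessel f (s : seq I) : L2 f -> uniq s -> (forall i, i \in s -> A i) ->
  \sum_(i <- s) sqc (inner mu f (e i)) <= sqn f.
Proof.
move=> Lf us As; rewrite -subr_ge0 -sqnorm_sub_projection//; exact: sqnorm_ge0.
Qed.

End Projection.

Lemma in_spanS (I : eqType) (A B : set I) (e : I -> T -> R[i]) f :
  A `<=` B -> in_span A e f -> in_span B e f.
Proof.
by move=> AB Af eta /Af[l Al fl]; exists l => // p /Al; exact: AB.
Qed.

Lemma orthonormal_basisP (I : eqType) (A : set I) (e : I -> T -> R[i]) V :
  V `<=` L2 ->
  orthonormal_basis mu A e V <->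
  [/\ forall i, A i -> V (e i), orthonormal_on A e & forall f, V f -> in_span A e f].
Proof.
move=> VL; split=> [[Ve ee fe]|[Ve [Le ee] fe]].
- have Le i : A i -> L2 (e i) by move=> /Ve/VL.
  by split=> // f Vf; apply/in_span_approx => //; [exact: VL|exact: fe].
- by split=> // f Vf; apply/in_span_approx => //; [exact: VL|exact: fe].
Qed.

Lemma closed_subspace_sum V (I : Type) (s : seq I) (a : I -> R[i]) (F : I -> T -> R[i]) :
  closed_subspace mu V -> (forall i, V (F i)) -> V (fun x => \sum_(i <- s) a i * F i x).
Proof.
move=> [_ V0 VD _] VF; elim: s => [|i s IH].
  by under eq_fun do rewrite big_nil.
by under eq_fun do rewrite big_cons; exact: VD.
Qed.

(** Orthogonality to a family extends to its closed span by Cauchy-Schwarz. *)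
Lemma inner_in_span (I : eqType) (A : set I) (e : I -> T -> R[i]) f g :
  (forall i, A i -> L2 (e i)) -> L2 f -> L2 g ->
  (forall i, A i -> inner mu f (e i) = 0) -> in_span A e g -> inner mu f g = 0.
Proof.
move=> Le Lf Lg fe Ag; apply/sqc_eq0/eqP; rewrite eq_le sqc_ge0 andbT.
apply/ler_addgt0Pl => eps eps0; rewrite addr0.
have f1 : 0 < sqn f + 1 by rewrite ltr_wpDl// sqnorm_ge0.
have [|l Al gl] := Ag (eps / (sqn f + 1)); first by rewrite divr_gt0.
have Ll := L2_combination Le Al.
have fl : inner mu f (combination e l) = 0.
  rewrite inner_sumr//; last by move=> p /Al; exact: Le.
  by rewrite big_seq big1// => p /Al Ap; rewrite fe// mulr0.
rewrite -[inner mu f g]subr0 -fl -innerBr//.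
apply: le_trans (Cauchy_Schwarz Lf (L2B Lg Ll)) _.
have := ltW gl; rewrite ler_pdivlMr// mulrC; apply: le_trans.
by rewrite ler_wpM2r ?sqnorm_ge0// lerDl.
Qed.

(** The terms of [l] that do not satisfy [a] are orthogonal both to [f] and to the
other terms; by Pythagoras, removing them does not increase the distance to
[f]. *)
Lemma sqnorm_combination_filter (I : eqType) (e : I -> T -> R[i]) (a : pred I) f l :
  L2 f -> (forall p, p \in l -> L2 (e p.2)) ->
  (forall p p', p \in l -> p' \in l -> a p.2 -> ~~ a p'.2 -> inner mu (e p.2) (e p'.2) = 0) ->
  (forall p, p \in l -> ~~ a p.2 -> inner mu f (e p.2) = 0) ->
  sqn (fun x => f x - combination e [seq p <- l | a p.2] x) <=
  sqn (fun x => f x - combination e l x).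
Proof.
move=> Lf Le orth fe.
set l1 := [seq p <- l | a p.2]; pose l2 := [seq p <- l | ~~ a p.2].
have L1 : L2 (combination e l1).
  by apply: L2_sum => p; rewrite mem_filter => /andP[_ /Le].
have L2' : L2 (combination e l2).
  by apply: L2_sum => p; rewrite mem_filter => /andP[_ /Le].
have -> : (fun x => f x - combination e l x) =
    (fun x => (f x - combination e l1 x) - combination e l2 x).
  apply/funext => x; rewrite /combination /l1 /l2 !big_filter.
  by rewrite (bigID (fun p => a p.2))/=; ring.
rewrite [leRHS]sqnormB//; last exact: L2B.
rewrite (_ : inner _ _ _ = 0) ?mulr0 ?subr0 ?lerDl ?sqnorm_ge0//=.
rewrite inner_sumr; last 2 first.
- by move=> p; rewrite mem_filter => /andP[_ /Le].
- exact: L2B.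
rewrite big_seq big1// => p; rewrite mem_filter => /andP[ap pl].
rewrite innerBl//; last exact: Le.
rewrite fe// sub0r inner_suml; last 2 first.
- by move=> p'; rewrite mem_filter => /andP[_ /Le].
- exact: Le.
rewrite big_seq big1 ?oppr0 ?mulr0// => p'; rewrite mem_filter => /andP[ap' p'l].
by rewrite orth// mulr0.
Qed.

End OrthonormalFamilies.

(** * Splitting an orthonormal family by filters *)

Lemma divn_digit q r n : (r < q)%N -> ((r + q * n) %/ q)%N = n.
Proof.
by move=> rq; rewrite addnC mulnC divnMDl ?divn_small ?addn0// (leq_ltn_trans _ rq).
Qed.

Lemma modn_digit q r n : (r < q)%N -> ((r + q * n) %% q)%N = r.
Proof. by move=> rq; rewrite addnC mulnC modnMDl modn_small. Qed.

Lemma ler_sum_inj (R : numDomainType) (I J : finType) (f : I -> J) (F : J -> R) :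
  injective f -> (forall j, 0 <= F j) -> \sum_i F (f i) <= \sum_j F j.
Proof.
move=> finj F0; rewrite [leRHS](bigID (mem (f @: [set: I]%SET))) /=.
rewrite (@big_imset _ _ _ _ _ f _ F) /=; last by move=> i i' _ _ /finj.
rewrite [X in _ <= X + _](eq_bigl xpredT); first by rewrite lerDl sumr_ge0.
by move=> i; rewrite finset.inE.
Qed.

Lemma cvg_finite_sum (R : realType) (I : Type) (s : seq I) (f : I -> nat -> R) (a : I -> R) :
  (forall i, f i N @[N --> \oo] --> a i) ->
  (\sum_(i <- s) f i N) @[N --> \oo] --> \sum_(i <- s) a i.
Proof.
move=> fa; elim: s => [|i s IH].
  by rewrite big_nil; under eq_fun do rewrite big_nil; exact: cvg_cst.
by rewrite big_cons; under eq_fun do rewrite big_cons; exact: cvgD.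
Qed.

Section Splitting.
Context d (T : measurableType d) (R : realType).
Variable mu : {measure set T -> \bar R}.
Variables (q : nat) (h : nat -> nat -> R[i]) (tau : nat -> nat -> nat).
Variables (A : set nat) (e g : nat * nat -> T -> R[i]).
Local Notation sqn := (sqnorm mu).

Hypothesis q_gt0 : (0 < q)%N.
Hypothesis tau_inj : forall l, injective (tau l).
Hypothesis tau_cover : forall j, exists J : nat -> nat, J 0%N = j /\
  forall k, exists i l, (i < q)%N /\ tau l k = J i.
Hypothesis gram : forall r r' l l', (r < q)%N -> (r' < q)%N ->
  ccvg (fun N => \sum_(k < N) \sum_(k' < N)
          h r k * (h r' k')^* * (tau l k == tau l' k')%:R)
       ((r == r') && (l == l'))%:R.
Hypothesis e_orth : orthonormal_on mu [set nk | A nk.1] e.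
Let B : set (nat * nat) := [set nk | A (nk.1 %/ q)%N].
Hypothesis g_lim : forall nl, B nl ->
  cvgL2 mu (fun N x => \sum_(k < N) h (nl.1 %% q)%N k *
                          e ((nl.1 %/ q)%N, tau nl.2 k) x) (g nl).

(** The index [(r + q * n, l)] stands for the [n]-th parent filtered by [h r] and
shifted by [l].  The inner product of two members is the limit of the inner
products of the partial sums, and those are the double sums controlled by
[gram]; for different parents they vanish identically. *)
Lemma splitting_orthonormal : orthonormal_on mu B g.
Proof.
split=> [nl /g_lim[]//|[n l] [n' l'] Bn Bn'].
apply: ccvg_unique (inner_cvg (g_lim Bn) (g_lim Bn')) _ => /=.
have E N : inner mu (fun x => \sum_(k < N) h (n %% q)%N k * e ((n %/ q)%N, tau l k) x)
    (fun x => \sum_(k < N) h (n' %% q)%N k * e ((n' %/ q)%N, tau l' k) x) =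
    ((n %/ q)%N == (n' %/ q)%N)%:R *
     (\sum_(k < N) \sum_(k' < N) h (n %% q)%N k * (h (n' %% q)%N k')^* *
          (tau l k == tau l' k')%:R).
  rewrite inner_suml; last 2 first.
  - by move=> k _; exact: e_orth.1.
  - by apply: L2_sum => k _; exact: e_orth.1.
  rewrite mulr_sumr; apply: eq_bigr => k _.
  rewrite inner_sumr; last 2 first.
  - by move=> k' _; exact: e_orth.1.
  - exact: e_orth.1.
  rewrite !mulr_sumr; apply: eq_bigr => k' _.
  rewrite e_orth.2// xpair_eqE.
  by case: eqP => _; case: eqP => _; rewrite /= ?(mul1r, mulr1, mul0r, mulr0).
have -> : ((n, l) == (n', l'))%:R = ((n %/ q)%N == (n' %/ q)%N)%:R *
    (((n %% q)%N == (n' %% q)%N) && (l == l'))%:R :> R[i].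
  rewrite -natrM mulnb xpair_eqE andbA; congr ((_ && _)%:R).
  apply/eqP/andP => [->//|[/eqP nq /eqP nr]].
  by rewrite (divn_eq n q) nq nr -divn_eq.
rewrite /ccvg; under eq_fun do rewrite E.
by apply: ccvgZ; apply: gram; rewrite ltn_mod.
Qed.

(** Only the [k]-th term of the series defining the member [(r + q n, l)] can meet
[e (n, j)], because [tau l] is injective. *)
Lemma inner_splitting n j r l k : A n -> (r < q)%N -> tau l k = j ->
  inner mu (g (r + q * n, l)%N) (e (n, j)) = h r k.
Proof.
move=> An rq tk.
have nE := divn_digit n rq; have rE := modn_digit n rq.
have Bn : B (r + q * n, l)%N by rewrite /B /= nE.
have Le : L2 mu (e (n, j)) by exact: e_orth.1.
have Lc : cvgL2 mu (fun=> e (n, j)) (e (n, j)).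
  apply/cvgL2P; split=> //; rewrite (_ : (fun _ => _) = fun=> 0); first exact: cvg_cst.
  by apply/funext => _; under eq_fun do rewrite subrr; rewrite sqnorm0.
apply: ccvg_unique (inner_cvg (g_lim Bn) Lc) _ => /=.
apply: ccvg_near (ccvg_cst _); rewrite nE rE.
near=> N.
have kN : (k < N)%N by near: N; exists k.+1.
rewrite inner_suml//; last by move=> k' _; exact: e_orth.1.
rewrite (bigD1 (Ordinal kN))//= e_orth.2// tk eqxx mulr1 big1 ?addr0// => k' kk'.
rewrite e_orth.2// xpair_eqE eqxx /= -tk (inj_eq (@tau_inj l)).
by rewrite (_ : (k' == k :> nat) = false) ?mulr0//; exact: negbTE.
Unshelve. all: by end_near. Qed.

(** The case [r = r'], [l = l' = 0] of [gram]. *)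
Lemma filter_norm r : (r < q)%N ->
  (\sum_(k < N) sqc (h r k)) @[N --> \oo] --> (1 : R).
Proof.
move=> rq; have := gram 0 0 rq rq; rewrite !eqxx /= => H.
have E N : \sum_(k < N) \sum_(k' < N) h r k * (h r k')^* * (tau 0 k == tau 0 k')%:R
   = real_complex R (\sum_(k < N) sqc (h r k)).
  rewrite rmorph_sum; apply: eq_bigr => k _ /=.
  rewrite (bigD1 k)//= eqxx mulr1 -sqcE big1 ?addr0// => k' k'k.
  rewrite (inj_eq (@tau_inj 0%N)) (_ : (k == k' :> nat) = false) ?mulr0//.
  by rewrite eq_sym; exact: negbTE.
apply/cvgrPdist_lt => eps eps0.
have {}H := cvgr_lt _ H _ (exprn_gt0 2 eps0).
near=> N.
have : sqc (\sum_(k < N) \sum_(k' < N) h r k * (h r k')^* *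
   (tau 0 k == tau 0 k')%:R - 1) < eps ^+ 2 by near: N; exact: H.
rewrite E -[1]/(real_complex R 1) -rmorphB.
rewrite /sqc /= expr0n addr0 -(real_normK (num_real _)) => HN.
by rewrite distrC -(ltr_pXn2r (ltn0Sn 1))// nnegrE// ltW.
Unshelve. all: by end_near. Qed.

(** The [q] vectors [e (n, J i)] together see every coefficient of the [q] filters,
whose squared norms add up to [q]; Bessel's inequality leaves at most 1 to each
of them, so that [e (n, j)], the one with [i = 0], attains equality. *)
Lemma splitting_complete n j : A n -> in_span mu B g (e (n, j)).
Proof.
move=> An eta eta0.
have [Lg gg] := splitting_orthonormal.
have Le j' : L2 mu (e (n, j')) by exact: e_orth.1.
have [J [J0 Jcov]] := tau_cover j.
have [N HN] : exists N, q%:R - eta < \sum_(r < q) \sum_(k < N) sqc (h r k).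
  have H : (\sum_(r < q) \sum_(k < N) sqc (h r k)) @[N --> \oo] --> (q%:R : R).
    have -> : (q%:R : R) = \sum_(r < q) 1 by rewrite sumr_const card_ord.
    by apply: cvg_finite_sum => r; exact: filter_norm.
  have [|N _ HN] := cvgr_gt _ H (q%:R - eta); first by rewrite ltrBlDr ltrDl.
  by exists N; exact: (HN N (leqnn N)).
have /choice[il Hil] : forall k, exists p : nat * nat, (p.1 < q)%N /\ tau p.2 k = J p.1.
  by move=> k; have [i [l [? ?]]] := Jcov k; exists (i, l).
(* [s] indexes enough of the new family to see the first [N] coefficients of
   every filter from the vectors [e (n, J i)]. *)
pose L := (\max_(k < N) (il k).2).+1.
pose s := [seq (r + q * n, l)%N | r <- iota 0 q, l <- iota 0 L].
have us : uniq s.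
  apply: allpairs_uniq; rewrite ?iota_uniq// => -[r l] [r' l'] _ _ /= [].
  by move=> /addIn -> ->.
have sB i : i \in s -> B i.
  move=> /allpairsP[[r l] /= [+ _ ->]]; rewrite mem_iota add0n /= => rq.
  by rewrite /B /= divn_digit.
pose b i := \sum_(nl <- s) sqc (inner mu (e (n, J i)) (g nl)).
have b1 i : b i <= 1.
  have := Bessel splitting_orthonormal (Le (J i)) us sB.
  have -> : sqn (e (n, J i)) = 1.
    by apply: (@complexI R); rewrite sqnormE e_orth.2// eqxx.
  by [].
have sum_b : \sum_(r < q) \sum_(k < N) sqc (h r k) <= \sum_(i < q) b i.
  rewrite /b /s; under [leRHS]eq_bigr do rewrite big_allpairs_dep /=.
  rewrite [leRHS]exchange_big/= -(big_mkord xpredT (fun r => \sum_(k < N) sqc (h r k))).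
  rewrite /index_iota subn0 big_seq [leRHS]big_seq; apply: ler_sum => r.
  rewrite mem_iota add0n /= => rq.
  have iP (k : 'I_N) : ((il k).1 < q)%N := (Hil k).1.
  have lP (k : 'I_N) : ((il k).2 < L)%N.
    by rewrite ltnS; exact: (@leq_bigmax _ (fun k : 'I_N => (il k).2) k).
  (* [f] is injective: [i] and [l] determine [tau l k], hence [k]. *)
  pose f (k : 'I_N) : 'I_q * 'I_L := (Ordinal (iP k), Ordinal (lP k)).
  have finj : injective f.
    move=> k k' [iE lE]; apply/val_inj/(@tau_inj (il k).2).
    by rewrite [in RHS]lE (Hil k).2 (Hil k').2 iE.
  pose F (p : 'I_q * 'I_L) := sqc (inner mu (e (n, J p.1)) (g (r + q * n, p.2 : nat)%N)).
  have -> : \sum_(i < q) \sum_(l <- iota 0 L) sqc (inner mu (e (n, J i)) (g (r + q * n, l)%N))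
     = \sum_p F p.
    under eq_bigr do rewrite -[iota 0 L]/(index_iota 0 L) big_mkord.
    by rewrite pair_bigA.
  apply: le_trans (ler_sum_inj finj _); last by move=> p; exact: sqc_ge0.
  apply: ler_sum => k _; rewrite /F /= innerC; last exact: Le.
    by rewrite (inner_splitting An rq (Hil k).2) sqcC.
  by apply: Lg; rewrite /B /= divn_digit.
exists [seq (inner mu (e (n, j)) (g nl), nl) | nl <- s].
  by move=> p /mapP[nl /sB + ->].
rewrite (_ : (fun x => _) = (fun x => e (n, j) x -
    \sum_(nl <- s) inner mu (e (n, j)) (g nl) * g nl x)); last first.
  by apply/funext => x; rewrite /combination big_map.
rewrite (sqnorm_sub_projection splitting_orthonormal)//.
have -> : sqn (e (n, j)) = 1.
  by apply: (@complexI R); rewrite sqnormE e_orth.2// eqxx.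
have : \sum_(i < q) b i <= b 0%N + (q%:R - 1).
  rewrite (bigD1 (Ordinal q_gt0))//= lerD2l.
  have -> : (q%:R - 1 : R) = \sum_(i < q | i != Ordinal q_gt0) 1.
    have -> : (q%:R : R) = \sum_(r < q) 1 by rewrite sumr_const card_ord.
    by rewrite (bigD1 (Ordinal q_gt0))//= addrAC subrr add0r.
  by apply: ler_sum => i _; exact: b1.
rewrite /b J0; move: HN sum_b; rewrite /b; lra.
Qed.

End Splitting.

(** * Affine maps and the absolute value of a local field *)

Section AffineMaps.
Variable K : topologicalFieldType.
Implicit Types a b x : K.

Definition affine b a x := b * x + a.

Lemma affineK b a : b != 0 -> cancel (affine b a) (affine b^-1 (- (b^-1 * a))).
Proof. by move=> b0 x; rewrite /affine mulrDr mulKf// addrK. Qed.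

Lemma affineVK b a : b != 0 -> cancel (affine b^-1 (- (b^-1 * a))) (affine b a).
Proof. by move=> b0 x; rewrite /affine mulrDr mulrN !mulVKf// subrK. Qed.

Lemma continuous_mull b : continuous (fun x => b * x).
Proof.
move=> x; apply: (@continuous_comp _ _ _ (fun x => (b, x)) (fun z : K * K => z.1 * z.2)).
  by apply: cvg_pair => /=; [exact: cvg_cst|exact: cvg_id].
exact: Defs.mul_continuous.
Qed.

Lemma continuous_addr a : continuous (fun x : K => x + a).
Proof.
move=> x; apply: (@continuous_comp _ _ _ (fun x => (x, a)) (fun z : K * K => z.1 + z.2)).
  by apply: cvg_pair => /=; [exact: cvg_id|exact: cvg_cst].
exact: add_continuous.
Qed.

Lemma continuous_affine b a : continuous (affine b a).
Proof.
move=> x; apply: (@continuous_comp _ _ _ (fun x => b * x) (fun x => x + a)).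
  exact: continuous_mull.
exact: continuous_addr.
Qed.

Lemma open_affine_preimage b a (A : set K) : open A -> open (affine b a @^-1` A).
Proof. by move=> oA; apply: open_comp => // x _; exact: continuous_affine. Qed.

Lemma measurable_affine b a :
  measurable_fun setT (affine b a : borelType K -> borelType K).
Proof.
apply: (@measurability _ _ (borelType K) (borelType K) setT (affine b a) (@open K)) => //.
move=> _ [B oB <-]; rewrite setTI; apply: sub_sigma_algebra.
exact: open_affine_preimage.
Qed.

Lemma borel_open (A : set K) : open A -> measurable (A : set (borelType K)).
Proof. by move=> oA; exact: sub_sigma_algebra. Qed.

Lemma affine_image b a (A : set K) : b != 0 ->
  affine b a @` A = affine b^-1 (- (b^-1 * a)) @^-1` A.
Proof.
move=> b0; apply/seteqP; split=> [_ [x Ax <-]|x Ax] /=.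
  by rewrite affineK.
by eexists; [exact: Ax|rewrite affineVK].
Qed.

Lemma scale_image b (A : set K) : b != 0 ->
  [set b * x | x in A] = affine b^-1 0 @^-1` A.
Proof.
move=> b0; rewrite -[0]oppr0 -(mulr0 b^-1) -affine_image//.
by congr image; apply/funext => x; rewrite /affine addr0.
Qed.

End AffineMaps.

Section Valuation.
Variables (R : realType) (K : topologicalFieldType) (q : nat).
Variables (mu : {measure set (borelType K) -> \bar R}) (abs : K -> R) (varpi : K).
Hypothesis lf : local_field K.
Hypothesis haar : haar_measure mu.
Hypothesis mod : modulus mu abs.
Hypothesis muD : mu (integers abs) = 1%E.
Hypothesis prime_varpi : prime_element abs varpi.
Hypothesis residue : residue_field abs q.

Local Notation D := (integers abs).
Local Notation P := (max_ideal abs).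

Lemma integers1 : D 1. Proof. by case: residue. Qed.
Lemma integersB x y : D x -> D y -> D (x - y). Proof. by case: residue => _ + _ _; exact. Qed.
Lemma integersM x y : D x -> D y -> D (x * y). Proof. by case: residue => _ _ + _; exact. Qed.
Lemma integers0 : D 0. Proof. by rewrite -(subrr 1); apply: integersB; exact: integers1. Qed.
Lemma integersN x : D x -> D (- x).
Proof. by move=> Dx; rewrite -[- x]add0r; exact: (integersB integers0 Dx). Qed.
Lemma integersD x y : D x -> D y -> D (x + y).
Proof. by move=> Dx /integersN Dy; rewrite -[y]opprK; exact: integersB. Qed.

(** Let [C] be a compact neighbourhood of 0.  For [b] near 0 the compact set [b C]
is contained in the interior of [C], by the tube lemma around [0 C = 0].
Comparing measures gives [|b| <= 1]. *)
Lemma near_integers : nbhs (0 : K) D.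
Proof.
have [_ _ lc] := lf; have [_ fin pos] := haar; have [abs0 absM] := mod.
have [C + [cC clC]] := lc 0 I.
rewrite /within /= => C0.
have nC : nbhs (0 : K) C by apply: filterS C0 => x; exact.
have C00 : C° 0 by rewrite /interior.
have : \forall b \near (0 : K), C `<=` (fun x => C° (b * x)).
  move/compact_near_coveringP : cC; apply => x Cx.
  have /(_ (C°)) H := @Defs.mul_continuous K (0, x).
  have /H : nbhs ((0 : K) * x) C°.
    by rewrite mul0r; exact: nbhs_interior.
  move=> [[U V] /= [U0 Vx] UV]; exists (V, U) => // -[y b] /= [Vy Ub].
  exact: (UV (b, y)).
apply: filterS => b bC; have [->|b0] := eqVneq b 0; first exact: integers0.
have mC : measurable (C° : set (borelType K)) by apply: borel_open; exact: open_interior.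
have muC : (0 < mu C°)%E by apply: pos; [exact: open_interior|exists 0].
have muC' : mu C° \is a fin_num.
  rewrite ge0_fin_numE//; apply: le_lt_trans (fin _ cC).
  apply: le_measure; rewrite ?inE//; last exact: interior_subset.
  rewrite -[C]setCK; apply: measurableC; apply: borel_open; exact: closed_openC.
have := absM b b0 _ mC.
have : (mu [set (b * x)%R | x in C°] <= mu C°)%E.
  apply: le_measure; rewrite ?inE//.
    rewrite scale_image// -[X in measurable X]setTI.
    exact: (measurable_affine _ _ measurableT).
  by move=> _ [x /interior_subset Cx <-]; exact: bC.
move=> + E; rewrite E -(fineK muC') -EFinM lee_fin -[leRHS]mul1r ler_pM2r//.
by rewrite fine_gt0// muC ltey_eq muC'.
Qed.

(** An additive subgroup containing a neighbourhood of 0 is open. *)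
Lemma open_integers : open D.
Proof.
rewrite openE => x Dx; rewrite /interior.
have H : nbhs x ((fun y => y - x) @^-1` D).
  by apply: (@continuous_addr K (- x) x); rewrite subrr; exact: near_integers.
apply: filterS H => y /= Dyx.
by rewrite -(subrK x y); exact: integersD.
Qed.

Lemma measurable_integers : measurable (D : set (borelType K)).
Proof. by apply: borel_open; exact: open_integers. Qed.

Lemma measure_scale_integers x : x != 0 -> mu [set x * y | y in D] = (abs x)%:E.
Proof. by move=> x0; rewrite mod.2// ?muD ?mule1//; exact: measurable_integers. Qed.

Lemma absM x y : abs (x * y) = abs x * abs y.
Proof.
have [->|x0] := eqVneq x 0; first by rewrite mul0r mod.1 mul0r.
have [->|y0] := eqVneq y 0; first by rewrite mulr0 mod.1 mulr0.
apply: EFin_inj; rewrite -measure_scale_integers ?mulf_neq0//.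
rewrite EFinM -(measure_scale_integers y0) -mod.2//; last first.
  rewrite scale_image// -[X in measurable X]setTI.
  exact: (measurable_affine _ _ measurableT measurable_integers).
congr (mu _); apply/seteqP; split.
  by move=> _ [z Dz <-]; exists (y * z); [exists z|rewrite mulrA].
by move=> _ [_ [z Dz <-] <-]; exists z => //; rewrite mulrA.
Qed.

Lemma abs1 : abs 1 = 1.
Proof.
apply: EFin_inj; rewrite -measure_scale_integers ?oner_neq0// -muD; congr (mu _).
by rewrite -[RHS]image_id; congr image; apply/funext => x; rewrite mul1r.
Qed.

Lemma abs_ge0 x : 0 <= abs x.
Proof.
have [->|x0] := eqVneq x 0; first by rewrite mod.1.
by rewrite -lee_fin -measure_scale_integers.
Qed.

Lemma abs_gt0 x : x != 0 -> 0 < abs x.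
Proof.
move=> x0; rewrite lt_def abs_ge0 andbT; apply/eqP => /(congr1 ( *%R^~ (abs x^-1))).
by rewrite -absM mulfV// abs1 mul0r => /eqP; rewrite oner_eq0.
Qed.

Lemma absV x : x != 0 -> abs x^-1 = (abs x)^-1.
Proof.
move=> x0; apply: (mulfI (lt0r_neq0 (abs_gt0 x0))).
by rewrite -absM !mulfV ?abs1// lt0r_neq0// abs_gt0.
Qed.

(** The closure of a point is connected, hence reduced to that point. *)
Lemma closed_point (x : K) : closed [set x].
Proof.
have [_ td _] := lf.
suff -> : [set x] = closure [set x] by exact: closed_closure.
apply/seteqP; split; first exact: subset_closure.
rewrite -[X in _ `<=` X](td x I); apply: connected_component_max => //.
- exact: subset_closure.
- exact/connected_closure/connected1.
Qed.

(** If [varpi] were 0 the maximal ideal would be 0 and the reduction map would be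
injective on the integers.  The integers would then be a finite neighbourhood
of 0, so that points would be open and [K] discrete. *)
Lemma varpi_neq0 : varpi != 0.
Proof.
apply/eqP => v0; have [nd _ _] := lf; apply: nd.
have P0 x : P x -> x = 0.
  move=> /prime_varpi.2; rewrite v0 mod.1 => x0; apply/eqP/negPn/negP => /abs_gt0.
  by rewrite ltNge x0.
have [_ _ _ [F [red [_ [_ redDM] redP redS]]]] := residue.
have red_inj x y : D x -> D y -> red x = red y -> x = y.
  move=> Dx Dy xy; have Dxy := integersB Dx Dy.
  have := (redDM _ _ Dxy Dy).1; rewrite subrK xy => /(congr1 (fun z => z - red y)).
  rewrite subrr addrK => /esym/(redP _ Dxy)/P0/eqP.
  by rewrite subr_eq0 => /eqP.
have point0 : nbhs (0 : K) [set 0].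
  have : \forall y \near (0 : K), D y /\ forall z : F, z != red 0 -> D y -> red y != z.
    near=> y; split; first by near: y; exact: near_integers.
    near: y; apply: filter_forall => z.
    have [->|z0] := eqVneq z (red 0); first by near=> y.
    have [x Dx xz] := redS z.
    have : nbhs (0 : K) (~` [set x]).
      apply: open_nbhs_nbhs; split; first by apply: closed_openC; exact: closed_point.
      by move=> x0; move: z0; rewrite -xz -x0 eqxx.
    apply: filterS => y yx _ Dy; apply/eqP => yz; apply: yx.
    by apply: red_inj; rewrite ?xz.
  apply: filterS => y [Dy /(_ (red y))]; rewrite eqxx => H.
  apply: red_inj => //; first exact: integers0.
  by apply/eqP/negPn/negP => /H/(_ Dy).
move=> A; rewrite openE => x Ax; rewrite /interior.
have H : nbhs x ((fun y => y - x) @^-1` [set 0]).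
  by apply: (@continuous_addr K (- x) x); rewrite subrr.
apply: filterS H => y /= /eqP.
by rewrite subr_eq0 => /eqP ->.
Unshelve. all: by end_near. Qed.

Lemma max_idealE x : P x <-> D (varpi^-1 * x).
Proof.
have v0 := varpi_neq0; have av := abs_gt0 v0.
rewrite /integers /= absM absV// mulrC ler_pdivrMr// mul1r.
by split=> [/prime_varpi.2//|xv]; exact: (le_lt_trans xv prime_varpi.1).
Qed.

Lemma measure_affine_preimage b a (A : set (borelType K)) : b != 0 -> measurable A ->
  mu (affine b a @^-1` A) = ((abs b)^-1%:E * mu A)%E.
Proof.
move=> b0 mA; have b'0 : b^-1 != 0 by rewrite invr_eq0.
have -> : affine b a @^-1` A = [set - (b^-1 * a) + x | x in [set b^-1 * x | x in A]].
  have -> : affine b a = affine (b^-1)^-1 (- ((b^-1)^-1 * - (b^-1 * a))).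
    by rewrite invrK mulrN opprK mulVKf.
  rewrite -affine_image//; apply/seteqP; split.
    by move=> _ [x Ax <-]; exists (b^-1 * x); [exists x|rewrite /affine addrC].
  by move=> _ [_ [x Ax <-] <-]; exists x => //; rewrite /affine addrC.
have [trans _ _] := haar; rewrite trans ?mod.2 ?absV//.
rewrite scale_image// -[X in measurable X]setTI.
exact: (measurable_affine _ _ measurableT).
Qed.

(** The image of [mu] under [x |-> b x + a] is a multiple of [mu]. *)
Lemma ge0_integral_affine b a (f : borelType K -> \bar R) : b != 0 ->
  measurable_fun setT f -> (forall x, (0 <= f x)%E) ->
  (\int[mu]_x f (affine b a x) = (abs b)^-1%:E * \int[mu]_x f x)%E.
Proof.
move=> b0 mf f0; pose phi : borelType K -> borelType K := affine b a.
have mphi : measurable_fun setT phi := @measurable_affine K b a.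
have c0 : 0 <= (abs b)^-1 by rewrite invr_ge0 abs_ge0.
transitivity (\int[pushforward mu phi]_x f x)%E.
  by rewrite (ge0_integral_pushforward mphi).
rewrite -[(abs b)^-1]/((NngNum c0)%:num) -ge0_integral_mscale//.
apply: (@eq_measure_integral _ _ _ _ (mscale (NngNum c0) mu)
  (measure_function_pushforward__canonical__measure_function_Measure mu mphi)) => A mA _.
by rewrite /= /pushforward measure_affine_preimage.
Qed.

End Valuation.

(** * Restriction to a set and affine changes of variables *)

Local Notation "f \on D" := (patch (fun=> 0) D f) (at level 40).

Lemma patch0E (T : Type) (R : realType) (f : T -> R[i]) (D : set T) x :
  (f \on D) x = (x \in D)%:R * f x.
Proof. by rewrite /patch; case: (x \in D); rewrite ?mul1r ?mul0r. Qed.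

Section Restriction.
Context d (T : measurableType d) (R : realType).
Variable mu : {measure set T -> \bar R}.
Implicit Types (f g : T -> R[i]) (D : set T).

Lemma cmeasurable_on f D : measurable D -> cmeasurable f -> cmeasurable (f \on D).
Proof.
move=> mD mf; rewrite (_ : f \on D = fun x => (Complex (\1_D x) 0) * f x); last first.
  apply/funext => x; rewrite patch0E indicE; congr (_ * _).
  by case: (x \in D).
apply: cmeasurableM => //; split => /=; last exact: measurable_cst.
exact: measurable_indic.
Qed.

Lemma cintegrable_on f D : measurable D -> cintegrable mu f -> cintegrable mu (f \on D).
Proof.
move=> mD If; have [m1 m2] := cmeasurable_on mD (cintegrable_meas If).
case: If => f1 f2; split.
- apply: le_integrable f1 => //; first exact/measurable_EFinP.
  by move=> x _; rewrite lee_fin /patch; case: ifP => //= _; rewrite normr0.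
- apply: le_integrable f2 => //; first exact/measurable_EFinP.
  by move=> x _; rewrite lee_fin /patch; case: ifP => //= _; rewrite normr0.
Qed.

Lemma cintegrable_bounded_on f D : measurable D -> (mu D < +oo)%E -> cmeasurable f ->
  (forall x, sqc (f x) <= 1) -> cintegrable mu (f \on D).
Proof.
move=> mD fD mf f1; have [m1 m2] := cmeasurable_on mD mf.
have I1 : mu.-integrable setT (EFin \o (\1_D : T -> R)).
  apply/integrableP; split; first exact/measurable_EFinP/measurable_indic.
  under eq_integral do rewrite /= ger0_norm//.
  by rewrite integral_indic// setIT.
have le1 (a b : R) : a ^+ 2 + b ^+ 2 <= 1 -> `|a| <= 1.
  move=> ab; rewrite -(@ler_pXn2r _ 2)// ?nnegrE// expr1n real_normK ?num_real//.
  by have := sqr_ge0 b; lra.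
split.
- apply: le_integrable I1 => //; first exact/measurable_EFinP.
  move=> x _; rewrite lee_fin /patch /= indicE; case: ifP => //= _; rewrite ?normr0// normr1.
  exact: le1 (f1 x).
- apply: le_integrable I1 => //; first exact/measurable_EFinP.
  move=> x _; rewrite lee_fin /patch /= indicE; case: ifP => //= _; rewrite ?normr0// normr1.
  by apply: (le1 _ (complex.Re (f x))); rewrite addrC; exact: (f1 x).
Qed.

Lemma cintegral_cst1 D : measurable D -> cintegral mu ((fun=> 1) \on D) = real_complex R (fine (mu D)).
Proof.
move=> mD; apply: complexP => /=.
- rewrite (_ : (fun x => _) = \1_D); last first.
    by apply/funext => x; rewrite /patch indicE; case: ifP.
  by rewrite /Rintegral integral_indic// setIT.
- under eq_Rintegral do rewrite patch0E /=.
  rewrite (_ : (fun x => _) = fun=> 0); first by rewrite Rintegral_cst// mul0r.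
  by apply/funext => x; case: (_ \in _); rewrite cImM /= ?(mulr0, mul0r, addr0).
Qed.

End Restriction.

Section ChangeOfVariables.
Variables (R : realType) (K : topologicalFieldType) (q : nat).
Variables (mu : {measure set (borelType K) -> \bar R}) (abs : K -> R).
Hypothesis lf : local_field K.
Hypothesis haar : haar_measure mu.
Hypothesis mod : modulus mu abs.
Hypothesis muD : mu (integers abs) = 1%E.
Hypothesis residue : residue_field abs q.
Variables (b a : K).
Hypothesis b0 : b != 0.
Local Notation L2 := (L2 mu).
Local Notation aff := (affine b a).
Let ge0_aff := ge0_integral_affine lf haar mod muD residue.

Lemma cmeasurable_affine (f : borelType K -> R[i]) : cmeasurable f ->
  cmeasurable (fun x : borelType K => f (aff x)).
Proof.
move=> [f1 f2]; have ma := @measurable_affine K b a.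
split; [exact: (measurableT_comp f1 ma)|exact: (measurableT_comp f2 ma)].
Qed.

Lemma integrable_affine (f : borelType K -> \bar R) : mu.-integrable setT f ->
  mu.-integrable setT (fun x : borelType K => f (aff x)).
Proof.
move=> /integrableP[mf fi]; apply/integrableP; split.
  exact: (measurableT_comp mf (@measurable_affine K b a)).
have mf' : measurable_fun setT (fun x => `|f x|%E) by exact: measurableT_comp.
rewrite (@ge0_aff b a (fun x => `|f x|%E))//.
by rewrite lte_mul_pinfty ?lee_fin ?invr_ge0 ?(abs_ge0 lf haar mod muD residue).
Qed.

Lemma Rintegral_affine (f : borelType K -> R) : mu.-integrable setT (EFin \o f) ->
  \int[mu]_x (f (aff x)) = (abs b)^-1 * \int[mu]_x (f x).
Proof.
move=> fi; have mf := measurable_int mu fi.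
have I := integrable_affine fi.
rewrite /Rintegral integralE [in RHS]integralE.
have Ep : (\int[mu]_x ((fun x : borelType K => (f (aff x))%:E)^\+ x) =
   (abs b)^-1%:E * \int[mu]_x ((EFin \o f)^\+ x))%E.
  rewrite -(@ge0_aff b a)//; last exact: measurable_funepos.
  by apply: eq_integral => x _; rewrite !funeposE.
have En : (\int[mu]_x ((fun x : borelType K => (f (aff x))%:E)^\- x) =
   (abs b)^-1%:E * \int[mu]_x ((EFin \o f)^\- x))%E.
  rewrite -(@ge0_aff b a)//; last exact: measurable_funeneg.
  by apply: eq_integral => x _; rewrite !funenegE.
rewrite Ep En.
have := integrable_pos_fin_num measurableT fi.
have := integrable_neg_fin_num measurableT fi.
move=> /fineK <- /fineK <-.
by rewrite -!EFinM -!EFinB /= mulrBr.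
Qed.

Lemma cintegrable_affine (f : borelType K -> R[i]) : cintegrable mu f ->
  cintegrable mu (fun x : borelType K => f (aff x)).
Proof. by move=> [f1 f2]; split; [exact: (integrable_affine f1)|exact: (integrable_affine f2)]. Qed.

Lemma cintegral_affine (f : borelType K -> R[i]) : cintegrable mu f ->
  cintegral mu (fun x : borelType K => f (aff x)) = (real_complex R (abs b)^-1) * cintegral mu f.
Proof.
move=> [f1 f2]; apply: complexP; rewrite ?cReM ?cImM /= mul0r ?subr0 ?addr0.
- exact: (Rintegral_affine f1).
- exact: (Rintegral_affine f2).
Qed.

Lemma L2_affine (f : borelType K -> R[i]) : L2 f -> L2 (fun x : borelType K => f (aff x)).
Proof.
move=> /L2P[mf fi]; apply/L2P; split; first exact: cmeasurable_affine.
exact: (integrable_affine fi).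
Qed.

Lemma inner_affine (f g : borelType K -> R[i]) : L2 f -> L2 g ->
  inner mu (fun x : borelType K => f (aff x)) (fun x : borelType K => g (aff x)) =
  (real_complex R (abs b)^-1) * inner mu f g.
Proof.
move=> Lf Lg; rewrite /inner -cintegral_affine//; exact: cintegrable_inner.
Qed.

Lemma sqnorm_affine (f : borelType K -> R[i]) : L2 f ->
  sqnorm mu (fun x : borelType K => f (aff x)) = (abs b)^-1 * sqnorm mu f.
Proof.
move=> Lf; apply: (@complexI R); rewrite rmorphM /= !sqnormE; exact: inner_affine.
Qed.

Lemma cvgL2_affine (G : nat -> borelType K -> R[i]) (g : borelType K -> R[i]) :
  cvgL2 mu G g ->
  cvgL2 mu (fun n x => G n (aff x)) (fun x => g (aff x)).
Proof.
move=> /cvgL2P[LG Lg Gg]; apply/cvgL2P; split.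
- by move=> n; exact: L2_affine.
- exact: L2_affine.
- rewrite -(mulr0 (abs b)^-1).
  rewrite (_ : (fun n => _) = (fun n => (abs b)^-1 * sqnorm mu (fun x => G n x - g x))).
    by apply: cvgM => //; exact: cvg_cst.
  by apply/funext => n; rewrite -sqnorm_affine//; exact: L2B.
Qed.

End ChangeOfVariables.

(** * Digits, characters and the Gram matrix of the filters *)

Lemma base_digits (p c : nat) (a : nat -> nat) : (0 < p)%N ->
  exists2 n, (n < p ^ c)%N & forall k, (k < c)%N -> (n %/ p ^ k %% p = a k %% p)%N.
Proof.
move=> p0; elim: c a => [|c IH] a; first by exists 0%N.
have [n' n'lt n'E] := IH (fun k => a k.+1).
have ap : (a 0 %% p < p)%N by rewrite ltn_mod.
exists (a 0 %% p + p * n')%N.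
  rewrite expnS; apply: (@leq_trans (p * n'.+1)); last by rewrite leq_mul2l n'lt orbT.
  by rewrite mulnS ltn_add2r.
case=> [_|k kc]; first by rewrite expn0 divn1 modn_digit.
by rewrite expnS divnMA divn_digit// n'E.
Qed.

Section Unimodular.
Context d (T : measurableType d) (R : realType).
Variable mu : {measure set T -> \bar R}.

Lemma sqnorm_mul_unimodular (f g : T -> R[i]) : (forall x, sqc (g x) = 1) ->
  sqnorm mu (fun x => f x * g x) = sqnorm mu f.
Proof.
by move=> g1; rewrite /sqnorm; apply: eq_Rintegral => x _; rewrite sqcM g1 mulr1.
Qed.

Lemma cvgL2_mul_unimodular (F : nat -> T -> R[i]) (f g : T -> R[i]) :
  cvgL2 mu F f -> cmeasurable g -> (forall x, sqc (g x) = 1) ->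
  cvgL2 mu (fun n x => F n x * g x) (fun x => f x * g x).
Proof.
move=> /cvgL2P[LF Lf Ff] mg g1; apply/cvgL2P; split.
- by move=> n; exact: L2_mul_unimodular.
- exact: L2_mul_unimodular.
- rewrite (_ : (fun n => _) = (fun n => sqnorm mu (fun x => F n x - f x)))//.
  apply/funext => n; rewrite -[RHS](sqnorm_mul_unimodular _ g1); congr sqnorm.
  by apply/funext => x; rewrite mulrBl.
Qed.

End Unimodular.

Lemma measurable_continuous (R : realType) (K : topologicalFieldType) (f : K -> R) :
  continuous f -> measurable_fun setT (f : borelType K -> R).
Proof.
move=> cf; apply: (measurability _ (RGenOpens.measurableE R)).
move=> _ [_ [a [b ->] <-]]; rewrite setTI; apply: borel_open; apply: open_comp => //.
Qed.

Section LocalField.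
Variables (R : realType) (K : topologicalFieldType) (p c : nat).
Variables (mu : {measure set (borelType K) -> \bar R}) (abs : K -> R).
Variables (varpi : K) (eps : nat -> K) (chi : K -> R[i]).
Let q := (p ^ c)%N.
Hypothesis lf : local_field K.
Hypothesis charp : p \in [pchar K].
Hypothesis haar : haar_measure mu.
Hypothesis mod : modulus mu abs.
Hypothesis muD : mu (integers abs) = 1%E.
Hypothesis prime_varpi : prime_element abs varpi.
Hypothesis residue : residue_field abs q.
Hypothesis basic_chi : basic_character abs p c eps varpi chi.
Variables (F : finFieldType) (iota : {rmorphism F -> K}).
Hypothesis cardF : #|F| = q.
Hypothesis eps0 : eps 0%N = 1.
Hypothesis iota_range : range iota =
  [set x | exists a : nat -> nat, x = \sum_(k < c) (a k)%:R * eps k].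

Local Notation D := (integers abs).
Local Notation un := (u p c eps varpi).
Let DB := integersB residue.
Let DD := integersD residue.
Let DM := integersM residue.
Let D0 := integers0 residue.
Let abs_ge0 := abs_ge0 lf haar mod muD residue.
Let abs_gt0 := abs_gt0 lf haar mod muD residue.
Let absM := absM lf haar mod muD residue.
Let abs1 := abs1 lf haar mod muD residue.
Let absV := absV lf haar mod muD residue.
Let varpi0 := varpi_neq0 lf haar mod muD prime_varpi residue.
Let max_idealE := max_idealE lf haar mod muD prime_varpi residue.
Let mD := measurable_integers lf haar mod residue.

Lemma q_gt1 : (1 < q)%N.
Proof. by rewrite -cardF; exact: finNzRing_gt1. Qed.

Lemma q_gt0 : (0 < q)%N. Proof. exact: ltnW q_gt1. Qed.

Lemma p_prime : prime p. Proof. exact: pcharf_prime charp. Qed.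

Lemma c_gt0 : (0 < c)%N.
Proof. by have := q_gt1; rewrite /q; case: (c). Qed.

Lemma absX x n : abs (x ^+ n) = abs x ^+ n.
Proof. by elim: n => [|n IH]; rewrite ?expr0 ?abs1// !exprS absM IH. Qed.

(** A nonzero element of the finite field is a root of unity. *)
Lemma abs_iota z : z != 0 -> abs (iota z) = 1.
Proof.
move=> z0; have z0' : iota z != 0 by rewrite fmorph_eq0.
have := congr1 (abs \o iota) (expf_card z); rewrite /= rmorphXn /= absX.
have := q_gt1; rewrite cardF; case: (q) => [|[|n]] // _.
rewrite exprS => /(canRL (mulKf (lt0r_neq0 (abs_gt0 z0')))).
rewrite mulVf ?lt0r_neq0 ?abs_gt0// => /eqP.
by rewrite pexpr_eq1 ?abs_ge0// => /eqP.
Qed.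

Lemma integers_iota z : D (iota z).
Proof.
have [->|z0] := eqVneq z 0; first by rewrite rmorph0.
by rewrite /integers /= abs_iota.
Qed.

Lemma iota_coset z z' : D (varpi^-1 * (iota z - iota z')) -> z = z'.
Proof.
move=> /max_idealE; rewrite -rmorphB /max_ideal /= => lt1.
by apply/eqP; rewrite -subr_eq0; apply: contraTT lt1 => /abs_iota ->; rewrite ltxx.
Qed.

(** The reduction map composed with [iota] is an injection between two fields with
[q] elements, hence a bijection. *)
Lemma coset_cover x : D x -> exists z, D (varpi^-1 * (x - iota z)).
Proof.
move=> Dx; have [_ _ _ [F' [red [cardF' [red1 redDM] redP redS]]]] := residue.
have redB y y' : D y -> D y' -> red (y - y') = red y - red y'.
  move=> Dy Dy'; have := (redDM _ _ (DB Dy Dy') Dy').1.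
  by rewrite subrK => ->; rewrite addrK.
pose f z := red (iota z).
have finj : injective f.
  move=> z z' ff; apply: iota_coset; apply/max_idealE.
  have DI := DB (integers_iota z) (integers_iota z').
  apply/(redP _ DI); rewrite redB; [|exact: integers_iota|exact: integers_iota].
  by rewrite -/(f z) -/(f z') ff subrr.
have [g fK gK] : bijective f by apply: inj_card_bij finj _; rewrite cardF cardF'.
exists (g (red x)); apply/max_idealE.
have DI := DB Dx (integers_iota (g (red x))).
apply/(redP _ DI); rewrite redB//; last exact: integers_iota.
by rewrite -/(f _) gK subrr.
Qed.

Lemma integers_affine z x : D x -> D (affine varpi (iota z) x).
Proof.
move=> Dx; apply: DD (integers_iota z); apply: DM Dx.
exact/ltW/prime_varpi.1.
Qed.

(** The integers are the disjoint union of the cosets [iota z + varpi D], and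
[x |-> varpi^-1 x - varpi^-1 iota z] maps such a coset onto [D]. *)
Lemma on_integers_cosets (f : K -> R[i]) x : (f \on D) x =
  \sum_z ((fun y => f (affine varpi (iota z) y)) \on D)
             (affine varpi^-1 (- (varpi^-1 * iota z)) x).
Proof.
have affE z : affine varpi^-1 (- (varpi^-1 * iota z)) x = varpi^-1 * (x - iota z).
  by rewrite /affine mulrBr.
have fE z : f (affine varpi (iota z) (affine varpi^-1 (- (varpi^-1 * iota z)) x)) = f x.
  by rewrite affineVK.
have [Dx|nDx] := pselect (D x).
  have [z Dz] := coset_cover Dx.
  rewrite (bigD1 z)//= !patch0E fE affE !mem_set// big1 ?addr0// => z' z'z.
  rewrite patch0E memNset ?mul0r// affE => Dz'; move/eqP : z'z; apply; apply: iota_coset.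
  have -> : iota z' - iota z = (x - iota z) - (x - iota z') by ring.
  by rewrite mulrBr; exact: DB.
rewrite patch0E memNset// mul0r big1// => z _.
rewrite patch0E memNset ?mul0r// => /(integers_affine z).
by rewrite affineVK.
Qed.

Lemma cintegral_cosets (f : K -> R[i]) :
  (forall z, cintegrable mu ((fun y : K => f (affine varpi (iota z) y)) \on D)) ->
  cintegral mu (f \on D) = (real_complex R (abs varpi)) *
    \sum_z cintegral mu ((fun y : K => f (affine varpi (iota z) y)) \on D).
Proof.
move=> If; have v0' : varpi^-1 != 0 by rewrite invr_eq0.
rewrite (cintegral_ext mu (@on_integers_cosets f)) cintegral_sum; last first.
  by move=> z; exact: (cintegrable_affine lf haar mod muD residue _ v0' (If z)).
rewrite mulr_sumr; apply: eq_bigr => z _.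
by rewrite (cintegral_affine lf haar mod muD residue _ v0' (If z)) absV// invrK.
Qed.

Lemma cintegral_one_integers : cintegral mu ((fun=> 1) \on D) = 1.
Proof. by rewrite cintegral_cst1 ?muD. Qed.

Lemma cintegrable_bounded_integers (f : K -> R[i]) : cmeasurable (f : borelType K -> R[i]) ->
  (forall x, sqc (f x) <= 1) -> cintegrable mu (f \on D).
Proof. by move=> mf f1; apply: cintegrable_bounded_on => //; rewrite muD ltry. Qed.

(** The integers, of measure 1, are cut into [q] translates of [varpi D], whose
measure is [|varpi|]. *)
Lemma abs_varpi : abs varpi = q%:R^-1.
Proof.
have := @cintegral_cosets (fun=> 1); rewrite cintegral_one_integers sumr_const cardF => H.
have q0 : (q%:R : R) != 0 by rewrite pnatr_eq0 -lt0n q_gt0.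
apply: (mulIf q0); rewrite mulVf//; apply: (@complexI R).
rewrite rmorphM rmorph_nat /= -H// => _.
apply: cintegrable_bounded_integers; first exact: cmeasurable_cst.
by move=> _; rewrite /sqc /= expr0n addr0 expr1n.
Qed.

Lemma digit_exists n : exists z, u_digit p c eps varpi n = iota z * varpi^-1.
Proof.
have : range iota (\sum_(k < c) (n %/ p ^ k %% p)%:R * eps k).
  by rewrite iota_range /=; exists (fun k => (n %/ p ^ k %% p)%N).
by move=> [z _ zE]; exists z; rewrite zE.
Qed.

Lemma digit_surj z : exists2 n, (n < q)%N & u_digit p c eps varpi n = iota z * varpi^-1.
Proof.
have : range iota (iota z) by exists z.
rewrite iota_range /= => -[a aE].
have [n nq nE] := base_digits c a (prime_gt0 p_prime).
exists n => //; congr (_ * _); rewrite aE; apply: eq_bigr => k _; congr (_ * _).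
by rewrite nE// (GRing.natr_mod_pchar charp).
Qed.

Definition digit n : F := projT1 (cid (digit_exists n)).

Lemma digitE n : u_digit p c eps varpi n = iota (digit n) * varpi^-1.
Proof. by rewrite /digit; case: cid. Qed.

Lemma iota_digitE n z : u_digit p c eps varpi n = iota z * varpi^-1 -> digit n = z.
Proof.
rewrite digitE => /(mulIf _)H; apply: (fmorph_inj iota); apply: H.
by rewrite invr_eq0.
Qed.

(** The digits [n < q] exhaust the [q] elements of the field. *)
Lemma digit_bij : bijective (fun n : 'I_q => digit n).
Proof.
have card : #|'I_q| = #|F| by rewrite card_ord cardF.
have surj z : exists n : 'I_q, digit n = z.
  by have [n nq /iota_digitE] := digit_surj z; exists (Ordinal nq).
have [g gK] := choice surj.
have ginj : injective g by move=> z z' /(congr1 (fun n : 'I_q => digit n)); rewrite !gK.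
have [f fK gfK] := inj_card_bij ginj (eq_leq card).
by exists g => // n; rewrite -{1}(gfK n) gK gfK.
Qed.

Lemma u_digit0 : u_digit p c eps varpi 0 = 0.
Proof. by rewrite /u_digit big1 ?mul0r// => k _; rewrite div0n mod0n mul0r. Qed.

Lemma digit0 : digit 0 = 0.
Proof. by apply: iota_digitE; rewrite u_digit0 rmorph0 mul0r. Qed.

(** The digits of [n] of index greater than [n] are 0. *)
Lemma u_wide n M : (n < M)%N ->
  un n = \sum_(s < M) u_digit p c eps varpi (n %/ q ^ s %% q) * varpi^-1 ^+ s.
Proof.
move=> nM; rewrite /u -/q -!(big_mkord xpredT (fun s =>
   u_digit p c eps varpi (n %/ q ^ s %% q) * varpi^-1 ^+ s)).
rewrite [RHS](big_cat_nat (n := n.+1))//= [X in _ = _ + X]big_nat_cond [X in _ = _ + X]big1 ?addr0//.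
move=> s /andP[/andP[ns _] _]; rewrite divn_small ?mod0n ?u_digit0 ?mul0r//.
by apply: leq_trans ns _; apply/ltnW/ltn_expl; exact: q_gt1.
Qed.

(** Horner form of [u].  Together with [digits_ind], this recursion is how all the
properties of [u] are obtained. *)
Lemma u_rec r n : (r < q)%N -> un (r + q * n) = u_digit p c eps varpi r + varpi^-1 * un n.
Proof.
move=> rq; set M := (r + q * n).+1.
have [nM|] := ltnP n M; last first.
  rewrite /M => rn; have n0 : n = 0%N.
    apply/eqP; rewrite -leqn0 leqNgt; apply/negP => n0.
    have := leq_ltn_trans (leq_addl r (q * n)) rn.
    by rewrite ltnNge leq_pmull ?q_gt0.
  have r0 : r = 0%N by move: rn; rewrite n0 muln0 addn0 ltn0.
  by move: rn; rewrite n0.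
rewrite (@u_wide n M)// (@u_wide _ M.+1)// big_ord_recl /= expn0 divn1 modn_digit//.
rewrite expr0 mulr1 mulr_sumr; congr (_ + _); apply: eq_bigr => s _.
rewrite /bump /= add1n expnS divnMA divn_digit// exprS; ring.
Qed.

Lemma u0 : un 0 = 0.
Proof. by rewrite /u big_ord_recl big_ord0 div0n mod0n u_digit0 mul0r addr0. Qed.

Lemma u_digitE r : (r < q)%N -> un r = iota (digit r) * varpi^-1.
Proof. by move=> rq; have := u_rec 0 rq; rewrite muln0 addn0 u0 mulr0 addr0 digitE. Qed.

Lemma u_mul l : un (q * l) = varpi^-1 * un l.
Proof. by have := @u_rec 0 l q_gt0; rewrite add0n u_digit0 add0r. Qed.

Lemma digits_ind (Q : nat -> Prop) : Q 0%N ->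
  (forall r n, (r < q)%N -> Q n -> Q (r + q * n)%N) -> forall n, Q n.
Proof.
move=> Q0 QS n; have [m] := ubnP n; elim: m n => // m IH [|n] //; rewrite ltnS => nm.
rewrite (divn_eq n.+1 q) addnC mulnC; apply: QS; first by rewrite ltn_mod q_gt0.
by apply: IH; apply: leq_trans nm; apply: ltn_Pdiv => //; exact: q_gt1.
Qed.

Lemma u_sub n n' : exists m, un m = un n - un n'.
Proof.
elim/digits_ind: n n' => [|r n rq IH] n'.
  elim/digits_ind: n' => [|r n rq [m mE]]; first by exists 0%N; rewrite u0 subrr.
  have [r' r'q r'E] := digit_surj (- digit r).
  exists (r' + q * m)%N; rewrite !u_rec// r'E mE rmorphN digitE u0; ring.
have -> : n' = (n' %% q + q * (n' %/ q))%N by rewrite mulnC addnC -divn_eq.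
have r'q : (n' %% q < q)%N by rewrite ltn_mod q_gt0.
have [m mE] := IH (n' %/ q)%N.
have [s sq sE] := digit_surj (digit r - digit (n' %% q)).
exists (s + q * m)%N; rewrite !u_rec// sE mE rmorphB !digitE; ring.
Qed.

Lemma u_opp n : exists m, un m = - un n.
Proof. by have [m mE] := u_sub 0 n; exists m; rewrite mE u0 sub0r. Qed.

Lemma u_add n n' : exists m, un m = un n + un n'.
Proof.
have [k kE] := u_opp n'; have [m mE] := u_sub n k.
by exists m; rewrite mE kE opprK.
Qed.

Let chiD x y : chi (x + y) = chi x * chi y. Proof. by case: basic_chi. Qed.
Let chi_int x : D x -> chi x = 1. Proof. by case: basic_chi => _ _ _ _; apply. Qed.

Lemma chi_sqc x : sqc (chi x) = 1.
Proof.
apply: (@complexI R); rewrite sqcE -normCK.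
by case: basic_chi => _ _ -> _ _; rewrite expr1n.
Qed.

Lemma chi_conj x : (chi x)^* = chi (- x).
Proof.
have H : chi x * chi (- x) = 1 by rewrite -chiD subrr chi_int//; exact: D0.
have H2 : chi x * (chi x)^* = 1 by rewrite -sqcE chi_sqc.
have c0 : chi x != 0 by apply: contra_eq_neq H => ->; rewrite mul0r eq_sym oner_neq0.
by apply: (mulfI c0); rewrite H.
Qed.

Lemma chi_sum1 (I : Type) (s : seq I) (f : I -> K) :
  (forall i, chi (f i) = 1) -> chi (\sum_(i <- s) f i) = 1.
Proof.
move=> f1; elim: s => [|i s IH]; first by rewrite big_nil chi_int//; exact: D0.
by rewrite big_cons chiD f1 IH mulr1.
Qed.

(** [chi] is trivial on [eps_k varpi^-j] for [j >= 2]. *)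
Lemma chi_iota z j : chi (iota z * varpi^-1 ^+ j.+2) = 1.
Proof.
have : range iota (iota z) by exists z.
rewrite iota_range /= => -[a ->]; rewrite mulr_suml; apply: chi_sum1 => k.
have [_ _ _ H _] := basic_chi; have := H k j.+2 (ltn_ord k).
rewrite andbF -exprnN -exprVn -mulrA mulr_natl => chi1.
elim: (a k) => [|n IHn]; first by rewrite mulr0n chi_int//; exact: D0.
by rewrite mulrS chiD IHn mulr1.
Qed.

(** All the terms of the product have degree at most -2 in [varpi]. *)
Lemma chi_u_small n z j : chi (un n * (iota z * varpi^-1 ^+ j.+1)) = 1.
Proof.
elim/digits_ind: n j => [|r n rq IH] j; first by rewrite u0 mul0r chi_int//; exact: D0.
rewrite u_rec// mulrDl chiD digitE.
have -> : iota (digit r) * varpi^-1 * (iota z * varpi^-1 ^+ j.+1) =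
  iota (digit r * z) * varpi^-1 ^+ j.+2 by rewrite rmorphM !exprS; ring.
rewrite chi_iota mul1r -(IH j.+1); congr chi; rewrite !exprS; ring.
Qed.

(** The value is [exp(2 pi i / p)], whose real part is less than 1 since
[0 < 2 pi / p <= pi]. *)
Lemma chi_varpi : chi (varpi^-1) != 1.
Proof.
have [_ _ _ H _] := basic_chi; have := H 0%N 1 c_gt0.
rewrite eps0 mul1r /= => ->; rewrite /expi; apply/eqP => -[+ _].
have p1 : (1 < p)%N := prime_gt1 p_prime.
have p0 : 0 < (p%:R : R) by rewrite ltr0n ltnW.
apply/eqP; rewrite lt_eqF// -[ltRHS](@cos0 R).
have pi2 : 2 * pi / p%:R <= (pi : R).
  by rewrite ler_pdivrMr// mulrC ler_pM2l ?pi_gt0// ler_nat.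
have pi0 : 0 < 2 * pi / (p%:R : R) by rewrite divr_gt0// mulr_gt0// pi_gt0.
rewrite ltr_cos// in_itv /= ?lexx ?pi_ge0//.
by rewrite pi2 (ltW pi0).
Qed.

(** Choose [d] so that the leading term of [u n * d] is [varpi^-1]; the other terms
are integers. *)
Lemma u_separated n : n != 0%N -> exists2 d, D d & chi (un n * d) != 1.
Proof.
elim/digits_ind: n => [|r n rq IH] // rn0.
have [n0|n0] := eqVneq n 0%N.
  move: rn0; rewrite n0 muln0 addn0 => r0; rewrite u_digitE//.
  have d0 : digit r != 0.
    have [g gK _] := digit_bij.
    apply: contra_neq r0 => d0.
    have := congr1 g (etrans d0 (esym digit0)).
    by rewrite (gK (Ordinal rq)) (gK (Ordinal q_gt0)) => -[].
  exists (iota (digit r)^-1); first exact: integers_iota.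
  by rewrite mulrAC -rmorphM /= mulfV// rmorph1 mul1r chi_varpi.
have [d Dd chid] := IH n0; exists (varpi * d).
  by apply: DM Dd; exact/ltW/prime_varpi.1.
rewrite u_rec// digitE mulrDl chiD.
have -> : iota (digit r) * varpi^-1 * (varpi * d) = iota (digit r) * d by field.
have -> : varpi^-1 * un n * (varpi * d) = un n * d by field.
by rewrite chi_int ?mul1r//; apply: DM Dd; exact: integers_iota.
Qed.

Lemma u_eq0 n : un n = 0 -> n = 0%N.
Proof.
move=> un0; apply/eqP/negPn/negP => /u_separated[d _].
by rewrite un0 mul0r chi_int ?eqxx//; exact: D0.
Qed.

(** If two sequences of digits differ beyond the lowest digit, the difference of
the tails is some [u m] with [m] nonzero, and a [d] separating it would send an
integer to a value of [chi] different from 1. *)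
Lemma u_inj : injective un.
Proof.
move=> n; elim/digits_ind: n => [|r n rq IH] n'; first by rewrite u0 => /esym/u_eq0.
have -> : n' = (n' %% q + q * (n' %/ q))%N by rewrite mulnC addnC -divn_eq.
have r'q : (n' %% q < q)%N by rewrite ltn_mod q_gt0.
set r' := (n' %% q)%N in r'q *; set n1 := (n' %/ q)%N.
rewrite !u_rec// => E.
have [m mE] := u_sub n n1.
have m0 : m = 0%N.
  apply/eqP/negPn/negP => /u_separated[d Dd /eqP]; apply.
  have -> : un m * d = (iota (digit r') - iota (digit r)) * d.
    have : varpi * (u_digit p c eps varpi r + varpi^-1 * un n) * d =
           varpi * (u_digit p c eps varpi r' + varpi^-1 * un n1) * d by rewrite E.
    rewrite mE !digitE => H.
    have -> : (un n - un n1) * d = varpi * (iota (digit r) * varpi^-1 + varpi^-1 * un n) * d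
       - (iota (digit r) + un n1) * d by field.
    by rewrite H; field.
  by apply: chi_int; apply: DM Dd; apply: DB; exact: integers_iota.
have nn1 : un n = un n1 by apply/eqP; rewrite -subr_eq0 -mE m0 u0.
move: E; rewrite nn1 => /addIr; rewrite !digitE.
have v0' : varpi^-1 != 0 by rewrite invr_eq0.
move=> /(mulIf v0')/(fmorph_inj iota) rr.
have [g gK _] := digit_bij.
have := congr1 g rr; rewrite (gK (Ordinal rq)) (gK (Ordinal r'q)) => -[->].
by rewrite (IH _ nn1).
Qed.

Lemma cmeasurable_chi a : cmeasurable (fun x : borelType K => (chi (a * x))^*).
Proof.
apply: cmeasurableC; have [cchi _ _ _ _] := basic_chi.
have cf : continuous (fun x : K => chi (a * x) : R[i]^o).
  move=> x; apply: (@continuous_comp _ _ _ (fun x => a * x) (chi : K -> R[i]^o)).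
    exact: continuous_mull.
  exact: cchi.
split; apply: measurable_continuous => x; apply/cvgrPdist_lt => e e0.
- have e0' : 0 < (real_complex R e) by rewrite ltcR.
  have /cvgrPdist_lt /(_ _ e0') := cf x; apply: filterS => y.
  rewrite normc_def ltcR; apply: le_lt_trans.
  rewrite -sqrtr_sqr ler_sqrt; last by rewrite addr_ge0 ?sqr_ge0.
  by case: (chi _) (chi _) => ? ? [? ?] /=; rewrite lerDl sqr_ge0.
- have e0' : 0 < (real_complex R e) by rewrite ltcR.
  have /cvgrPdist_lt /(_ _ e0') := cf x; apply: filterS => y.
  rewrite normc_def ltcR; apply: le_lt_trans.
  rewrite -sqrtr_sqr ler_sqrt; last by rewrite addr_ge0 ?sqr_ge0.
  by case: (chi _) (chi _) => ? ? [? ?] /=; rewrite lerDr sqr_ge0.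
Qed.

Lemma sqc_chiC x : sqc (chi x)^* = 1. Proof. by rewrite sqcC chi_sqc. Qed.

Lemma cintegrable_chi a : cintegrable mu ((fun x => (chi (a * x))^*) \on D).
Proof.
apply: cintegrable_bounded_integers; first exact: cmeasurable_chi.
by move=> x; rewrite sqc_chiC.
Qed.

Lemma L2_chi a : L2 mu ((fun x => (chi (a * x))^*) \on D).
Proof.
apply/L2P; split; first by apply: cmeasurable_on => //; exact: cmeasurable_chi.
have [I _] : cintegrable mu ((fun=> 1) \on D).
  apply: cintegrable_bounded_integers; first exact: cmeasurable_cst.
  by move=> _; rewrite /sqc /= expr0n addr0 expr1n.
rewrite (_ : (fun x => _) = (fun x => (complex.Re (((fun=> 1) \on D) x))%:E))//.
apply/funext => x; congr EFin; rewrite /patch; case: ifP => _; first exact: sqc_chiC.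
by rewrite sqc0.
Qed.

(** For [m] nonzero, translating the integers by a [d] with [chi (u m * d)]
different from 1 multiplies the integral by a number different from 1. *)
Lemma cintegral_chi m : cintegral mu ((fun x => (chi (un m * x))^*) \on D) = (m == 0%N)%:R.
Proof.
have [->|/u_separated[d Dd chid]] := eqVneq m 0%N.
  rewrite -cintegral_one_integers; congr cintegral; apply/funext => x.
  by rewrite !patch0E u0 mul0r chi_int ?rmorph1//; exact: D0.
set I := cintegral _ _.
have : I = (chi (un m * d))^* * I.
  rewrite -cintegralZ; last exact: cintegrable_chi.
  have := cintegral_affine lf haar mod muD residue d (oner_neq0 K) (cintegrable_chi (un m)).
  rewrite abs1 invr1 mul1r -/I => <-; apply: cintegral_ext => x.
  rewrite /affine mul1r !patch0E mulrDr chiD rmorphM /=.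
  have -> : (x + d \in D) = (x \in D).
    apply/idP/idP; rewrite !inE => H; last exact: DD.
    by rewrite -(addrK d x); exact: DB.
  ring.
move=> /eqP; rewrite -subr_eq0 -{1}[I]mul1r -mulrBl mulf_eq0 subr_eq0 => /orP[|/eqP->//].
rewrite eq_sym => /eqP/(congr1 Num.conj); rewrite conjCK rmorph1 => /eqP.
by rewrite (negbTE chid).
Qed.

Lemma inner_chi k k' : inner mu ((fun x => (chi (un k * x))^*) \on D)
  ((fun x => (chi (un k' * x))^*) \on D) = (k == k')%:R.
Proof.
have [m mE] := u_sub k k'.
have -> : (k == k') = (m == 0%N).
  apply/eqP/eqP => [kk|m0]; first by apply: u_eq0; rewrite mE kk subrr.
  by apply: u_inj; apply/eqP; rewrite -subr_eq0 -mE m0 u0.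
rewrite -cintegral_chi /inner; apply: cintegral_ext => x; rewrite !patch0E mE mulrBl chiD -chi_conj.
rewrite !rmorphM /= !conjCK conjC_nat.
by case: (x \in D); rewrite ?mul0r ?mul1r.
Qed.

(** Multiplication by [varpi^-1] maps the group of the [u n] into itself. *)
Lemma shift_exists : exists tau : nat -> nat -> nat,
  forall l k, un (tau l k) = un k + varpi^-1 * un l.
Proof.
have /choice[f fE] : forall p : nat * nat, exists m, un m = un p.2 + varpi^-1 * un p.1.
  by move=> [l k] /=; rewrite -u_mul; exact: u_add.
by exists (fun l k => f (l, k)) => l k; rewrite fE.
Qed.

Section Gram.
Variable tau : nat -> nat -> nat.
Hypothesis tauE : forall l k, un (tau l k) = un k + varpi^-1 * un l.

Lemma tau_inj l : injective (tau l).
Proof. by move=> k k' /(congr1 un); rewrite !tauE => /addIr/u_inj. Qed.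

(** The elements [u i] with [i < q] represent the cosets of the subgroup formed by
the [varpi^-1 * u l]. *)
Lemma tau_cover j : exists J : nat -> nat, J 0%N = j /\
  forall k, exists i l, (i < q)%N /\ tau l k = J i.
Proof.
have /choice[J JE] := fun i => u_add j i; exists J; split.
  by apply: u_inj; rewrite JE u0 addr0.
move=> k; have [m mE] := u_sub k j.
have [l lE] := u_opp (m %/ q).
exists (m %% q)%N, l; split; first by rewrite ltn_mod q_gt0.
apply: u_inj; rewrite tauE JE lE.
have : un m = un (m %% q)%N + varpi^-1 * un (m %/ q)%N.
  have mq : (m %% q < q)%N by rewrite ltn_mod q_gt0.
  rewrite [in LHS](divn_eq m q) addnC mulnC u_rec//; congr (_ + _).
  by rewrite digitE u_digitE.
rewrite mE => H; rewrite mulrN -(subrK (un j) (un k)) H; ring.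
Qed.

Variables (h : nat -> nat -> R[i]) (m : nat -> K -> R[i]).
Hypothesis m_symbol : forall l, (l <= q - 1)%N -> symbol mu abs q un chi (h l) (m l).
Hypothesis m_unitary : unitary_filters mu q varpi un m.

Let Xi l (x : borelType K) : R[i] := (chi (varpi^-1 * un l * x))^*.

Lemma symbol_integers r : (r < q)%N ->
  cvgL2 mu (fun N => (fun x : K => (sqrtC q%:R)^-1 *
      \sum_(k < N) h r k * (chi (un k * x))^*) \on D) (m r \on D).
Proof.
move=> rq; have rq' : (r <= q - 1)%N by rewrite subn1 -ltnS prednK// q_gt0.
have := m_symbol rq' 0.
rewrite (_ : [set 0 + x | x in D] = D)//.
by rewrite -[RHS]image_id; congr image; apply/funext => x; rewrite add0r.
Qed.

(** Multiplying by a character shifts the Fourier coefficients. *)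
Lemma symbol_shifted r l : (r < q)%N ->
  cvgL2 mu (fun N x => \sum_(k < N) (sqrtC q%:R)^-1 * h r k *
              ((fun x => (chi (un (tau l k) * x))^*) \on D) x)
    (fun x => (m r \on D) x * Xi l x).
Proof.
move=> rq; have := cvgL2_mul_unimodular (symbol_integers rq)
  (cmeasurable_chi (varpi^-1 * un l)) (fun x => sqc_chiC _).
congr (cvgL2 _ _ _); apply/funext => N; apply/funext => x.
rewrite patch0E mulr_sumr mulr_sumr mulr_suml; apply: eq_bigr => k _.
rewrite patch0E tauE mulrDl chiD rmorphM /=; ring.
Qed.

Lemma sqrtq_norm : (sqrtC q%:R)^-1 * ((sqrtC q%:R)^-1)^* = (q%:R)^-1 :> R[i].
Proof.
by rewrite -normCK normfV ger0_norm ?sqrtC_ge0 ?ler0n// exprVn sqrtCK.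
Qed.

Lemma inner_symbol_partial r r' l l' N :
  inner mu (fun x => \sum_(k < N) (sqrtC q%:R)^-1 * h r k *
              ((fun x => (chi (un (tau l k) * x))^*) \on D) x)
           (fun x => \sum_(k < N) (sqrtC q%:R)^-1 * h r' k *
              ((fun x => (chi (un (tau l' k) * x))^*) \on D) x) =
  q%:R^-1 * \sum_(k < N) \sum_(k' < N) h r k * (h r' k')^* * (tau l k == tau l' k')%:R.
Proof.
rewrite inner_suml; last 2 first.
- by move=> k _; exact: L2_chi.
- by apply: L2_sum => k _; exact: L2_chi.
rewrite mulr_sumr; apply: eq_bigr => k _.
rewrite inner_sumr; last 2 first.
- by move=> k' _; exact: L2_chi.
- exact: L2_chi.
rewrite !mulr_sumr; apply: eq_bigr => k' _.
rewrite inner_chi rmorphM /= -sqrtq_norm; ring.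
Qed.

(** For [k < q] the elements [varpi * u k] are the [iota z]. *)
Lemma unitary_sum r r' (x : K) : (r < q)%N -> (r' < q)%N ->
  (\matrix_(l < q, k < q) m l (varpi * x + varpi * un k)) \is unitarymx ->
  \sum_z m r (affine varpi (iota z) x) * (m r' (affine varpi (iota z) x))^* = (r == r')%:R.
Proof.
move=> rq r'q /unitarymxP /matrixP /(_ (Ordinal rq) (Ordinal r'q)).
rewrite !mxE => <-; rewrite (reindex (fun n : 'I_q => digit n)); last first.
  exact/onW_bij/digit_bij.
apply: eq_bigr => k _; rewrite !mxE /affine.
have -> : varpi * un k = iota (digit k) by rewrite u_digitE//; field.
by [].
Qed.

(** Cut the integers into the cosets [iota z + varpi D].  Since
[chi (u n * (iota z * varpi^-1)) = 1], the factor [Xi l * conj(Xi l')] becomes the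
same function [x |-> conj(chi (u n * x))] on all of them, where
[u n = u l - u l'].  The sum over the cosets is then an entry of [M M^*] times
this character. *)
Lemma inner_symbols r r' l l' : (r < q)%N -> (r' < q)%N ->
  inner mu (fun x => (m r \on D) x * Xi l x) (fun x => (m r' \on D) x * Xi l' x) =
  q%:R^-1 * ((r == r') && (l == l'))%:R.
Proof.
move=> rq r'q; have [_ L1 _] := symbol_shifted l rq; have [_ L2 _] := symbol_shifted l' r'q.
have := cintegrable_inner L1 L2; rewrite /inner.
set f := (fun x => _) => If.
have -> : f = f \on D.
  apply/funext => x; rewrite /f !patch0E.
  by case: (x \in D); rewrite ?mul0r ?mul1r.
have If' z : cintegrable mu ((fun y : K => f (affine varpi (iota z) y)) \on D).
  by apply: cintegrable_on => //; exact: (cintegrable_affine lf haar mod muD residue _ varpi0 If).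
rewrite cintegral_cosets// abs_varpi fmorphV rmorph_nat; congr (_ * _).
rewrite -cintegral_sum//.
have [n nE] := u_sub l l'.
transitivity (cintegral mu (fun x => (r == r')%:R * ((fun x => (chi (un n * x))^*) \on D) x)).
  apply: cintegral_ae.
  - by apply: cintegrable_meas; exact: cintegrable_sum.
  - by apply: cintegrable_meas; apply: cintegrableZ; exact: cintegrable_chi.
  apply: (@filterS _ _ (ae_filter_ringOfSetsType mu) _ _ _ m_unitary) => x /(unitary_sum rq r'q) <-.
  rewrite patch0E mulr_suml; apply: eq_bigr => z _; rewrite patch0E.
  have [Dx|nDx] := pselect (D x); last by rewrite memNset// !mul0r mulr0.
  rewrite mem_set// !mul1r /f !patch0E mem_set ?mul1r; last exact: integers_affine.
  rewrite rmorphM mulrACA; congr (_ * _).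
  rewrite /Xi -rmorphM /= chi_conj -chiD; congr Num.conj.
  rewrite -[RHS]mulr1 -(chi_u_small n z 0) -chiD; congr chi.
  rewrite nE /affine; by field.
rewrite (cintegralZ _ (cintegrable_chi (un n))) cintegral_chi.
rewrite -natrM mulnb; congr ((_ && _)%:R).
apply/eqP/eqP => [n0|ll]; first by apply: u_inj; apply/eqP; rewrite -subr_eq0 -nE n0 u0.
by apply: u_eq0; rewrite nE ll subrr.
Qed.

(** The double sums are, up to the factor [q], inner products of partial sums of
the shifted symbols. *)
Lemma gram r r' l l' : (r < q)%N -> (r' < q)%N ->
  ccvg (fun N => \sum_(k < N) \sum_(k' < N)
          h r k * (h r' k')^* * (tau l k == tau l' k')%:R)
       ((r == r') && (l == l'))%:R.
Proof.
move=> rq r'q.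
have := ccvgZ q%:R (inner_cvg (symbol_shifted l rq) (symbol_shifted l' r'q)).
have q0 : q%:R != 0 :> R[i] by rewrite pnatr_eq0 -lt0n q_gt0.
rewrite inner_symbols// mulrA mulfV// mul1r; apply: ccvg_near.
by exists 0%N => // N _; rewrite inner_symbol_partial mulrA mulfV// mul1r.
Qed.

(** * Wavelet packets *)

Variables (V : int -> set (K -> R[i])) (phi : K -> R[i]) (omega : nat -> K -> R[i]).
Hypothesis V_mra : MRA mu varpi un V phi.
Hypothesis packets : wavelet_packets mu q varpi un chi phi h m omega.

Let w (nk : nat * nat) : borelType K -> R[i] := translates un (omega nk.1) nk.2.
Let A (j : nat) : set (nat * nat) := [set nk | (nk.1 < q ^ j)%N].
Let V_closed j : closed_subspace mu (V j). Proof. by case: V_mra. Qed.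
Let V_L2 j : V j `<=` L2 mu. Proof. by case: (V_closed j). Qed.
Let onbP (I : eqType) (B : set I) (e : I -> borelType K -> R[i]) j :=
  @orthonormal_basisP _ _ R mu I B e (V j) (@V_L2 j).
Let q0 : q%:R != 0 :> R. Proof. by rewrite pnatr_eq0 -lt0n q_gt0. Qed.
Let varpiV0 : varpi^-1 != 0. Proof. by rewrite invr_eq0. Qed.

Let dilated (nk : nat * nat) : borelType K -> R[i] :=
  fun x => sqrtC q%:R * omega nk.1 (varpi^-1 * x - un nk.2).

Lemma dilatedE nk : dilated nk = (fun x : borelType K => sqrtC q%:R * w nk (affine varpi^-1 0 x)).
Proof. by apply/funext => x; rewrite /dilated /w /translates /affine addr0. Qed.

(** The dilation multiplies inner products by [|varpi| = 1/q], which the factor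
[q^(1/2)] in [dilated] compensates. *)
Lemma dilation_orthonormal_basis j :
  orthonormal_basis mu (A j) w (V j%:Z) -> orthonormal_basis mu (A j) dilated (V (j%:Z + 1)).
Proof.
move=> /onbP[Vw [Lw ww] Vspan].
have [_ [_ _ dil _]] := V_mra.
have sqn_q : sqc (sqrtC q%:R : R[i]) = q%:R.
  apply: (@complexI R); rewrite sqcE -normCK ger0_norm ?sqrtC_ge0 ?ler0n// sqrtCK.
  by rewrite rmorph_nat.
have sq0 : sqrtC q%:R != 0 :> R[i] by rewrite sqrtC_eq0 pnatr_eq0 -lt0n q_gt0.
have Vd nk : A j nk -> V (j%:Z + 1) (dilated nk).
  move=> /Vw/dil Vnk; have [_ V0 VD _] := V_closed (j%:Z + 1).
  have := VD (sqrtC q%:R) _ _ Vnk V0; congr (V _ _).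
  by apply/funext => x; rewrite addr0.
apply/onbP; split=> //.
  split=> [nk /Vd/V_L2//|nk nk' Ank Ank'].
  have Lnk := L2_affine lf haar mod muD residue 0 varpiV0 (Lw _ Ank).
  have Lnk' := L2_affine lf haar mod muD residue 0 varpiV0 (Lw _ Ank').
  rewrite !dilatedE innerZl//; last exact: L2Z.
  rewrite innerZr// mulrA -sqcE sqn_q.
  rewrite (inner_affine lf haar mod muD residue 0 varpiV0 (Lw _ Ank) (Lw _ Ank')).
  rewrite ww// absV// abs_varpi invrK mulrA -rmorphM mulfV//.
  by rewrite rmorph1 mul1r.
move=> f Vf eta eta0.
pose f' (x : borelType K) := f (varpi * x).
have f'E : f = (fun x => f' (affine varpi^-1 0 x)).
  by apply/funext => x; rewrite /f' /affine addr0 mulVKf.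
have Vf' : V j%:Z f'.
  apply/dil; rewrite (_ : (fun x => _) = f)//.
  by apply/funext => x; rewrite /f' mulVKf.
have [l Al fl] := Vspan _ Vf' _ eta0.
exists [seq (p.1 / sqrtC q%:R, p.2) | p <- l]; first by move=> t /mapP[t' /Al + ->].
have Ll := L2_combination Lw Al.
apply: le_lt_trans fl.
have -> : (fun x => f x - combination dilated [seq (p.1 / sqrtC q%:R, p.2) | p <- l] x) =
   (fun x : borelType K => (fun x => f' x - combination w l x) (affine varpi^-1 0 x)).
  apply/funext => x; rewrite {1}f'E /combination big_map; congr (_ - _).
  by apply: eq_bigr => t _; rewrite dilatedE /= mulrA divfK.
have LB := L2B (V_L2 Vf') Ll.
rewrite (sqnorm_affine lf haar mod muD residue 0 varpiV0 LB).
rewrite absV// invrK abs_varpi ler_piMl ?sqnorm_ge0// invf_le1 ?ler1n ?q_gt0//.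
by rewrite ltr0n q_gt0.
Qed.

(** The refinement equation translated by [u l]; the packet of index [n] has
parent [n %/ q] and filter [n %% q]. *)
Lemma packet_limit nl :
  cvgL2 mu (fun N x => \sum_(k < N) h (nl.1 %% q)%N k *
                          dilated ((nl.1 %/ q)%N, tau nl.2 k) x) (w nl).
Proof.
have [_ _ ref] := packets.
have rq : (nl.1 %% q <= q - 1)%N by rewrite subn1 -ltnS prednK ?q_gt0// ltn_mod q_gt0.
have := ref (nl.1 %/ q)%N _ rq; rewrite /refinement.
have -> : (nl.1 %% q + q * (nl.1 %/ q))%N = nl.1 by rewrite mulnC addnC -divn_eq.
move=> /(cvgL2_affine lf haar mod muD residue (- un nl.2) (oner_neq0 K)).
congr (cvgL2 _ _ _).
- apply/funext => N; apply/funext => x; rewrite mulr_sumr; apply: eq_bigr => k _.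
  rewrite /dilated /affine mul1r tauE mulrCA; do 2 congr (_ * _).
  by congr omega; rewrite /= mulrDr; ring.
- by apply/funext => x; rewrite /affine mul1r.
Qed.

Lemma packets_orthonormal_basis j : orthonormal_basis mu (A j) w (V j%:Z).
Proof.
elim: j => [|j IH].
  have [_ [_ _ _ [Vphi /onbP[Vt [Lt tt] Vspan]]]] := V_mra.
  have omega0 : omega 0%N = phi by case: packets.
  have A0 nk : A 0 nk -> nk = (0%N, nk.2).
    by case: nk => n k; rewrite /A /= expn0 ltnS leqn0 => /eqP ->.
  have w0 nk : A 0 nk -> w nk = translates un phi nk.2.
    by move=> /A0 ->; rewrite /w /= omega0.
  apply/onbP; split=> [nk /w0 ->||].
  - exact: Vt.
  - split=> [nk /w0 ->|nk nk' Ank Ank']; first exact: Lt.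
    by rewrite !w0// tt// (A0 _ Ank) (A0 _ Ank') xpair_eqE eqxx.
  move=> f Vf eta eta0; have [l _ fl] := Vspan _ Vf _ eta0.
  exists [seq (p.1, (0%N, p.2)) | p <- l].
    by move=> t /mapP[t' _ ->]; rewrite /A /= expn0.
  rewrite (_ : combination _ _ = combination (translates un phi : nat -> borelType K -> R[i]) l)//.
  by apply/funext => x; rewrite /combination big_map; under eq_bigr do rewrite /w /= omega0.
have VS : V j.+1%:Z = V (j%:Z + 1) by rewrite -addn1 PoszD.
rewrite VS.
have /onbP[Vd od Vspan] := dilation_orthonormal_basis IH.
have AE : A j.+1 = [set nk | ((nk.1 %/ q)%N < q ^ j)%N].
  apply/seteqP; split=> nk; rewrite /A /= expnSr; by rewrite ltn_divLR ?q_gt0.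
have glim (nl : nat * nat) : ((nl.1 %/ q)%N < q ^ j)%N -> _ := fun _ => packet_limit nl.
have ow := @splitting_orthonormal _ _ _ mu q h tau [set n | (n < q ^ j)%N] dilated w
  q_gt0 gram od glim.
have sp := @splitting_complete _ _ _ mu q h tau [set n | (n < q ^ j)%N] dilated w
  q_gt0 tau_inj tau_cover gram od glim.
apply/onbP; rewrite AE; split=> //.
- move=> nk Ank; have [_ _ _ Vlim] := V_closed (j%:Z + 1).
  apply: Vlim (packet_limit nk) => N.
  by apply: closed_subspace_sum => // k; exact: Vd.
- move=> f Vf; apply: (in_span_trans od.1 ow.1 (V_L2 Vf) _ (Vspan f Vf)).
  by move=> [n k] /= Ank; exact: sp.
Qed.

Lemma V_mono (i : int) n : V i `<=` V (i + n%:Z).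
Proof.
have [_ [Vinc _ _ _]] := V_mra.
elim: n => [|n IH]; first by rewrite addr0.
by rewrite -addn1 PoszD addrA => f /IH/Vinc.
Qed.

Lemma packets_orthonormal_basis_L2 : orthonormal_basis mu setT w (L2 mu).
Proof.
have Lw nk : L2 mu (w nk).
  have /onbP[Vw _ _] := packets_orthonormal_basis nk.1.
  by apply: (V_L2 (j := nk.1)); apply: Vw; rewrite /A /= ltn_expl// q_gt1.
apply/orthonormal_basisP => //; split=> //.
  split=> // nk nk' _ _; pose j := maxn nk.1 nk'.1.
  have /onbP[_ [_ ww] _] := packets_orthonormal_basis j.
  have lej n : (n <= j)%N -> (n < q ^ j)%N.
    by move=> nj; apply: leq_ltn_trans nj _; rewrite ltn_expl// q_gt1.
  by apply: ww; apply: lej; rewrite ?leq_maxl ?leq_maxr.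
move=> f Lf; apply: in_span_closure => // eta eta0.
have [_ [_ [dense _] _ _]] := V_mra.
have sq0 : 0 < Num.sqrt eta by rewrite sqrtr_gt0.
(* The scale [j] may be negative, but the spaces increase with the scale. *)
have [g [j _ Vg] fg] := dense f Lf _ sq0.
have [J VJg] : exists J : nat, V J%:Z g.
  case: j Vg => n Vg; first by exists n.
  exists 0%N; have := V_mono n.+1 Vg; rewrite NegzE addNr.
  by [].
have Lg := V_L2 VJg.
exists g; split=> //; last first.
  by move: fg; rewrite cnorm_lt ?sqr_sqrtr//; [exact: ltW|exact: L2B].
have /onbP[_ _ span] := packets_orthonormal_basis J.
by apply: in_spanS (span g VJg).
Qed.

Lemma packets_orthonormal_basis_detail j :
  orthonormal_basis mu (A j.+1 `\` A j) w (ominus mu (V (j%:Z + 1)) (V j%:Z)).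
Proof.
have VS : V j.+1%:Z = V (j%:Z + 1) by rewrite -addn1 PoszD.
have /onbP[Vw [Lw ww] span] := packets_orthonormal_basis j.
have := packets_orthonormal_basis j.+1; rewrite VS.
move=> /onbP[Vw' [Lw' ww'] span'].
have AS : A j `<=` A j.+1.
  by move=> nk /leq_trans; apply; rewrite leq_exp2l// q_gt1.
have WL : ominus mu (V (j%:Z + 1)) (V j%:Z) `<=` L2 mu by move=> f [/V_L2].
apply/(@orthonormal_basisP _ _ R mu _ _ _ _ WL); split.
- move=> nk [Ank nAnk]; split; first exact: Vw'.
  move=> g Vg; apply: (inner_in_span Lw (Lw' _ Ank) (V_L2 Vg) _ (span _ Vg)).
  move=> nk' Ank'; rewrite ww'//; last exact: AS.
  by case: eqP => // E; rewrite E in nAnk.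
- by split=> [nk [/Lw']//|nk nk' [+ _] [+ _]]; exact: ww'.
move=> f [Vf fV] eta eta0; have [l Al fl] := span' _ Vf _ eta0.
(* Drop from [l] the packets that belong to [V j]. *)
exists [seq p <- l | (q ^ j <= p.2.1)%N].
  move=> t; rewrite mem_filter => /andP[jt /Al At]; split=> //.
  by rewrite /A /= ltnNge jt.
apply: le_lt_trans fl.
apply: (sqnorm_combination_filter (e := w) (a := fun nk => (q ^ j <= nk.1)%N)) => //.
- exact: V_L2 Vf.
- by move=> t /Al/Lw'.
- move=> t t' /Al At /Al At' jt jt'; rewrite ww'//.
  by case: eqP => // E; rewrite -E jt in jt'.
- by move=> t _; rewrite -ltnNge => At; apply: fV; exact: Vw.
Qed.

End Gram.

End LocalField.

Theorem theorem2 (R : realType) (K : topologicalFieldType) (p c : nat)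
  (mu : {measure set (borelType K) -> \bar R}) (abs : K -> R)
  (varpi : K) (eps : nat -> K) (chi : K -> R[i])
  (V : int -> set (K -> R[i])) (phi : K -> R[i])
  (h : nat -> nat -> R[i]) (m : nat -> K -> R[i]) (omega : nat -> K -> R[i])
  (q := (p ^ c)%N) (un := u p c eps varpi) :
  local_field K ->
  p \in [pchar K] ->
  haar_measure mu ->
  modulus mu abs ->
  mu (integers abs) = 1%E ->
  prime_element abs varpi ->
  residue_field abs q ->
  residue_basis abs p c eps ->
  basic_character abs p c eps varpi chi ->
  MRA mu varpi un V phi ->
  (forall l, (l <= q - 1)%N -> ell2 (h l)) ->
  refinement mu q varpi un (h 0%N) phi phi ->
  (forall l, (l <= q - 1)%N -> symbol mu abs q un chi (h l) (m l)) ->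
  unitary_filters mu q varpi un m ->
  wavelet_packets mu q varpi un chi phi h m omega ->
  [/\ forall j : nat,
        orthonormal_basis mu
          [set nk : nat * nat | (q ^ j <= nk.1 <= q ^ j.+1 - 1)%N]
          (fun nk => translates un (omega nk.1) nk.2)
          (ominus mu (V (j%:Z + 1)) (V j%:Z)),
      forall j : nat,
        orthonormal_basis mu
          [set nk : nat * nat | (0 <= nk.1 <= q ^ j - 1)%N]
          (fun nk => translates un (omega nk.1) nk.2)
          (V j%:Z) &
      orthonormal_basis mu [set: nat * nat]
        (fun nk => translates un (omega nk.1) nk.2)
        (L2 mu)].
Proof.
move=> lf charp haar mod muD prime residue [eps0 _ [F [iota [cardF iotaR]]]].
move=> basic_chi mra _ _ symbols unitary packets.
have q1 : (1 < q)%N by rewrite /q -cardF; exact: finNzRing_gt1.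
have qj_gt0 j : (0 < q ^ j)%N by rewrite expn_gt0 (ltnW q1).
have leB j n : (n <= q ^ j - 1)%N = (n < q ^ j)%N by rewrite subn1 -ltnS prednK.
have [tau tauE] := shift_exists varpi charp cardF iotaR.
split=> [j|j|].
- have -> : [set nk : nat * nat | (q ^ j <= nk.1 <= q ^ j.+1 - 1)%N] =
    [set nk | (nk.1 < q ^ j.+1)%N] `\` [set nk | (nk.1 < q ^ j)%N].
    apply/seteqP; split=> nk /=; rewrite leB.
      by move=> /andP[qn nq]; split=> //; apply/negP; rewrite -leqNgt.
    by move=> [nq /negP]; rewrite -leqNgt => ->.
  exact: (packets_orthonormal_basis_detail lf charp haar mod muD prime residue basic_chi
    cardF eps0 iotaR tauE symbols unitary mra packets).
- have -> : [set nk : nat * nat | (0 <= nk.1 <= q ^ j - 1)%N] =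
    [set nk | (nk.1 < q ^ j)%N].
    by apply/seteqP; split=> nk /=; rewrite leB.
  exact: (packets_orthonormal_basis lf charp haar mod muD prime residue basic_chi
    cardF eps0 iotaR tauE symbols unitary mra packets).
- exact: (packets_orthonormal_basis_L2 lf charp haar mod muD prime residue basic_chi
    cardF eps0 iotaR tauE symbols unitary mra packets).
Qed.
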